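(* Let $A$ be a finitely generated graded associative unital algebra over $\mathbb{Q}$, generated by elements of degree $1$, such that the commutative ring $X:=A_{\mathrm{ab}}$ has Krull dimension at most $1$. Assume moreover that the number of non-reduced points of $\mathrm{Spec}\,X$ is finite. Then $B_k(A)$ and $N_j(A)$ are finite-dimensional $\mathbb{Q}$-vector spaces for all $k\geq 3$ and all $j\geq 2$.
   Context: For an associative unital algebra $A$, let $[a,b]=ab-ba$, let $L_1(A)=A$ and $L_{k+1}(A)=[A,L_k(A)]$ (the linear span of all $[a,b]$ with $a\in A$, $b\in L_k(A)$), let $M_k(A)$ be the two-sided ideal of $A$ generated by $L_k(A)$, and let $B_k(A)=L_k(A)/L_{k+1}(A)$ and $N_k(A)=M_k(A)/M_{k+1}(A)$. The abelianization of $A$ is $A_{\mathrm{ab}}=A/M_2(A)$. A point of $\mathrm{Spec}\,X$ is non-reduced if the local ring of $X$ at that point is not reduced. *)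

(* Defs.v *)
From HB Require Import structures.
From mathcomp Require Import all_boot all_order all_algebra.
From mathcomp Require Import generic_quotient ring_quotient.
From mathcomp Require Import boolp classical_sets cardinality.
From mathcomp Require Import ring.

Set Implicit Arguments.
Unset Strict Implicit.
Unset Printing Implicit Defensive.

Import GRing.Theory.
Local Open Scope classical_set_scope.
Local Open Scope ring_scope.
Local Open Scope quotient_scope.

Record subspace (R : pzRingType) (V : lmodType R) := Subspace {
  subspace_set :> set V;
  subspaceP : submod_closed [in subspace_set] }.

Definition span (R : pzRingType) (V : lmodType R) (S : set V) : set V :=
  smallest (fun W : set V => submod_closed [in W]) S.

Lemma span_submod_closed (R : pzRingType) (V : lmodType R) (S : set V) :
  submod_closed [in span S].
Proof.
split=> [|a u v]; rewrite ?inE => /=; first by move=> W [[/set_mem]].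
move=> Su Sv W /= WS; move: (WS) => [[_ Wl] _].
by apply/set_mem/Wl; apply/mem_set; [apply: Su|apply: Sv].
Qed.

Section SubspaceType.
Variables (R : pzRingType) (V : lmodType R) (U : subspace V).

Definition subspace_pred : {pred V} := [in subspace_set U].

HB.instance Definition _ := GRing.isSubmodClosed.Build R V subspace_pred
  (GRing.submod_closed_semi (subspaceP U)).

Definition subspace_type := {x : V | x \in subspace_pred}.

HB.instance Definition _ := Choice.on subspace_type.
HB.instance Definition _ := SubChoice.on subspace_type.
HB.instance Definition _ :=
  [SubChoice_isSubLmodule of subspace_type by <:].

End SubspaceType.

Section QuotientModule.
Variables (R : pzRingType) (V : lmodType R) (W : subspace V).

Definition quot_mod := Quotient.quot (subspace_pred W).

HB.instance Definition _ := EqQuotient.on quot_mod.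
HB.instance Definition _ := GRing.Zmodule.on quot_mod.

Lemma quot_mod_eqP (x y : V) :
  reflect (\pi_quot_mod x = \pi_quot_mod y) (x - y \in subspace_pred W).
Proof. by rewrite (Quotient.idealrBE (subspace_pred W)); exact: eqP. Qed.

Lemma quot_modD (x y : V) :
  \pi_quot_mod (x + y) = \pi_quot_mod x + \pi_quot_mod y.
Proof. exact: (Quotient.pi_add (subspace_pred W)). Qed.

Definition quot_scale (a : R) (q : quot_mod) : quot_mod :=
  \pi_quot_mod (a *: repr q).

Lemma quot_scaleE a x : quot_scale a (\pi_quot_mod x) = \pi_quot_mod (a *: x).
Proof.
apply/quot_mod_eqP; rewrite -scalerBr; apply: rpredZ.
by apply/quot_mod_eqP; rewrite reprK.
Qed.

Fact quot_scaleA a b q : quot_scale a (quot_scale b q) = quot_scale (a * b) q.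
Proof. by rewrite -[q]reprK (quot_scaleE b) !quot_scaleE scalerA. Qed.
Fact quot_scale1 : left_id 1 quot_scale.
Proof. by move=> q; rewrite -[q]reprK quot_scaleE scale1r. Qed.
Fact quot_scaleDr : right_distributive quot_scale +%R.
Proof.
by move=> a p q; rewrite -[p]reprK -[q]reprK -quot_modD !quot_scaleE scalerDr
   quot_modD.
Qed.
Fact quot_scaleDl q : {morph quot_scale^~ q : a b / a + b}.
Proof. by move=> a b; rewrite -[q]reprK !quot_scaleE scalerDl quot_modD. Qed.

HB.instance Definition _ := GRing.Zmodule_isLmodule.Build R quot_mod
  quot_scaleA quot_scale1 quot_scaleDr quot_scaleDl.

End QuotientModule.

Section Subquotient.
Variables (R : pzRingType) (V : lmodType R) (U W : subspace V).

Definition sub_inter_set : set (subspace_type U) := val @^-1` subspace_set W.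

Lemma sub_inter_submod_closed : submod_closed [in sub_inter_set].
Proof.
have [W0 Wl] := subspaceP W.
split=> [|a u v]; rewrite !inE /sub_inter_set /=; first exact/set_mem.
by move=> Wu Wv; apply/set_mem/Wl; apply/mem_set.
Qed.

(* U / (U `&` W), which is U / W when W `<=` U; see [lcsS], [lcs_idealS]. *)
Definition subquot := quot_mod (Subspace sub_inter_submod_closed).

HB.instance Definition _ := GRing.Lmodule.on subquot.

End Subquotient.

Definition fin_dim (F : fieldType) (V : lmodType F) : Prop :=
  exists n : nat, inhabited (Vector.axiom n V).

Definition two_sided_ideal (R : pzRingType) (I : set R) : Prop :=
  [/\ I 0, forall x y, I x -> I y -> I (x + y)
    & forall a x, I x -> I (a * x) /\ I (x * a)].

Section LowerCentralSeries.
Variables (F : fieldType) (A : algType F).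

Definition comm (a b : A) : A := a * b - b * a.

(* The series starts at index 1; the value at 0 is a dummy. *)
Fixpoint lcs (k : nat) : set A :=
  match k with
  | (_.+1 as k').+1 => span [set x | exists a b, lcs k' b /\ x = comm a b]
  | _ => setT
  end.

Definition lcs_ideal (k : nat) : set A := smallest (@two_sided_ideal A) (lcs k).

Lemma lcsS k : lcs k.+1 `<=` lcs k.
Proof.
elim: k => [//|[|k] IH]; first by [].
apply: smallest_sub; first exact: span_submod_closed.
by move=> _ [a [b [/IH lb ->]]]; apply: sub_gen_smallest; exists a, b.
Qed.

Lemma lcs_idealS k : lcs_ideal k.+1 `<=` lcs_ideal k.
Proof. by move=> x Ix I [II sI]; apply: Ix; split=> // y /lcsS /sI. Qed.

Lemma lcs_submod_closed k : submod_closed [in lcs k].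
Proof.
case: k => [|[|k]]; last exact: span_submod_closed;
  by split=> [|a u v _ _]; rewrite inE.
Qed.

Lemma lcs_ideal_two_sided k : two_sided_ideal (lcs_ideal k).
Proof.
split=> [I [[]]//|x y Ix Iy I II|a x Ix].
  by case: (II) => -[_ ID _] _; apply: ID; [apply: Ix|apply: Iy].
by split=> I II; case: (II) => -[_ _ IM] _; have [] := IM a x (Ix I II).
Qed.

Lemma lcs_ideal_submod_closed k : submod_closed [in lcs_ideal k].
Proof.
have [I0 ID IM] := lcs_ideal_two_sided k.
split=> [|a u v]; rewrite !inE// => Iu Iv; apply: ID => //.
by rewrite -[u]mul1r scalerAl; case: (IM (a *: 1) u Iu).
Qed.

Definition lcs_subspace k : subspace A := Subspace (lcs_submod_closed k).
Definition lcs_ideal_subspace k : subspace A :=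
  Subspace (lcs_ideal_submod_closed k).

Definition B_quot (k : nat) := subquot (lcs_subspace k) (lcs_subspace k.+1).
Definition N_quot (k : nat) :=
  subquot (lcs_ideal_subspace k) (lcs_ideal_subspace k.+1).

HB.instance Definition _ k := GRing.Lmodule.on (B_quot k).
HB.instance Definition _ k := GRing.Lmodule.on (N_quot k).

Definition abelianization := quot_mod (lcs_ideal_subspace 2).

HB.instance Definition _ := EqQuotient.on abelianization.
HB.instance Definition _ := GRing.Lmodule.on abelianization.

Local Notation pr := (\pi_abelianization).

Lemma ab_eqP (x y : A) : pr x = pr y <-> lcs_ideal 2 (x - y).
Proof.
split=> [/(@quot_mod_eqP _ _ (lcs_ideal_subspace 2))|h]; first by move/set_mem.
by apply/(@quot_mod_eqP _ _ (lcs_ideal_subspace 2))/mem_set.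
Qed.

Definition ab_one : abelianization := pr 1.
Definition ab_mul (x y : abelianization) : abelianization :=
  pr (repr x * repr y).

Lemma ab_mulE x y : ab_mul (pr x) (pr y) = pr (x * y).
Proof.
have [_ ID IM] := lcs_ideal_two_sided 2.
apply/ab_eqP.
rewrite (_ : _ - _ = repr (pr x) * (repr (pr y) - y) + (repr (pr x) - x) * y).
  by apply: ID; [apply: (IM _ _ _).1|apply: (IM _ _ _).2];
     apply/ab_eqP; rewrite reprK.
by rewrite mulrBr mulrBl addrA addrNK.
Qed.

Fact ab_mulA : associative ab_mul.
Proof.
move=> x y z; rewrite -[x]reprK -[y]reprK -[z]reprK.
by rewrite (ab_mulE (repr x) (repr y)) (ab_mulE (repr y)) !ab_mulE mulrA.
Qed.
Fact ab_mulC : commutative ab_mul.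
Proof.
move=> x y; rewrite -[x]reprK -[y]reprK !ab_mulE; apply/ab_eqP.
apply: sub_gen_smallest; apply: sub_gen_smallest.
by exists (repr x), (repr y).
Qed.
Fact ab_mul1 : left_id ab_one ab_mul.
Proof. by move=> x; rewrite -[x]reprK ab_mulE mul1r. Qed.
Fact ab_mulDl : left_distributive ab_mul +%R.
Proof.
move=> x y z; rewrite -[x]reprK -[y]reprK -[z]reprK.
rewrite -(@quot_modD _ _ (lcs_ideal_subspace 2)).
rewrite (ab_mulE (repr x) (repr z)) (ab_mulE (repr y)) ab_mulE mulrDl.
exact: (@quot_modD _ _ (lcs_ideal_subspace 2)).
Qed.

HB.instance Definition _ := GRing.Zmodule_isComPzRing.Build abelianization
  ab_mulA ab_mulC ab_mul1 ab_mulDl.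

Record is_grading (gr : nat -> set A) : Prop := IsGrading {
  gr_submod : forall n, submod_closed [in gr n];
  gr_one : gr 0%N 1;
  gr_mul : forall i j x y, gr i x -> gr j y -> gr (i + j)%N (x * y);
  gr_sum : forall x, exists n (c : nat -> A),
    (forall i, gr i (c i)) /\ x = \sum_(i < n) c i;
  gr_direct : forall n (c : nat -> A), (forall i, gr i (c i)) ->
    \sum_(i < n) c i = 0 -> forall i, (i < n)%N -> c i = 0 }.

Definition generates (S : set A) : Prop :=
  smallest (fun C : set A => subalg_closed [in C]) S = setT.

Definition finitely_generated : Prop :=
  exists S : set A, finite_set S /\ generates S.

End LowerCentralSeries.

Arguments lcs {F} A k.
Arguments lcs_ideal {F} A k.
Arguments lcs_subspace {F} A k.
Arguments lcs_ideal_subspace {F} A k.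
Arguments B_quot {F} A k.
Arguments N_quot {F} A k.
Arguments abelianization {F} A.
Arguments finitely_generated {F} A.

(* The classes [idealr] and [prime_idealr] of the library require a nonzero
   ring, and an abelianization can be zero. *)
Record prime_ideal (X : comPzRingType) (P : set X) : Prop := PrimeIdeal {
  prime_two_sided : two_sided_ideal P;
  prime_proper : ~ P 1;
  prime_mul : forall a b, P (a * b) -> P a \/ P b }.

Record Spec (X : comPzRingType) := SpecPoint {
  spec_set :> set X;
  spec_prime : prime_ideal spec_set }.

Definition krull_dim_le (X : comPzRingType) (n : nat) : Prop :=
  forall (m : nat) (c : nat -> Spec X),
    (forall i, (i < m)%N -> (c i : set X) `<` c i.+1) -> (m <= n)%N.

Definition reduced (X : comPzRingType) : Prop :=
  forall (x : X) (n : nat), x ^+ n = 0 -> x = 0.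

Section LocalRing.
Variables (X : comPzRingType) (p : Spec X).

Definition denominator := {s : X | s \in ~` (p : set X)}.
HB.instance Definition _ := Choice.on denominator.

Lemma denominatorP (s : denominator) : ~ spec_set p (val s).
Proof. exact: (set_mem (valP s)). Qed.

Lemma denominator1_subproof : 1 \in ~` (p : set X).
Proof. exact/mem_set/(prime_proper (spec_prime p)). Qed.

Lemma denominatorM_subproof (s t : denominator) :
  val s * val t \in ~` (p : set X).
Proof.
apply/mem_set => /(prime_mul (spec_prime p))[]; exact: denominatorP.
Qed.

Definition denominator1 : denominator := exist _ 1 denominator1_subproof.
Definition denominatorM (s t : denominator) : denominator :=
  exist _ (val s * val t) (denominatorM_subproof s t).

Definition frac := (X * denominator)%type.
HB.instance Definition _ := Choice.on frac.

Definition frac_equiv (u v : frac) : bool :=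
  `[< exists t : denominator,
        val t * (u.1 * val v.2) = val t * (v.1 * val u.2) >].

Lemma frac_equiv_is_equiv : equiv_class_of frac_equiv.
Proof.
split=> [u|u v|v u w].
- by apply/asboolP; exists denominator1.
- by apply/asboolP/asboolP => -[t e]; exists t.
move=> /asboolP[s es] /asboolP[t et]; apply/asboolP.
exists (denominatorM (denominatorM s t) v.2) => /=.
move: es et; set a := u.1; set b := val u.2; set c := v.1; set d := val v.2.
set e := w.1; set f := val w.2; set s' := val s; set t' := val t => es et.
have -> : s' * t' * d * (a * f) = (s' * (a * d)) * (t' * f) by ring.
have -> : s' * t' * d * (e * b) = (t' * (e * d)) * (s' * b) by ring.
by rewrite es -et; ring.
Qed.

Canonical frac_equiv_equiv := EquivRelPack frac_equiv_is_equiv.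
Canonical frac_equiv_encModRel := defaultEncModRel frac_equiv.

Definition local_ring := {eq_quot frac_equiv}.

HB.instance Definition _ : EqQuotient frac frac_equiv local_ring :=
  EqQuotient.on local_ring.
HB.instance Definition _ := Choice.on local_ring.

Local Notation pr := (\pi_local_ring).

Lemma local_eqP (u v : frac) : pr u = pr v <->
  exists t : denominator, val t * (u.1 * val v.2) = val t * (v.1 * val u.2).
Proof.
by split=> [/eqP|h]; [|apply/eqP]; rewrite piE => *; apply/asboolP.
Qed.

Lemma repr_local (u : frac) : exists t : denominator,
  val t * ((repr (pr u)).1 * val u.2) = val t * (u.1 * val (repr (pr u)).2).
Proof. by apply/local_eqP; rewrite reprK. Qed.

Definition frac_add (u v : frac) : frac :=
  (u.1 * val v.2 + v.1 * val u.2, denominatorM u.2 v.2).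
Definition frac_mul (u v : frac) : frac := (u.1 * v.1, denominatorM u.2 v.2).
Definition frac_opp (u : frac) : frac := (- u.1, u.2).

Definition local_zero : local_ring := pr (0, denominator1).
Definition local_one : local_ring := pr (1, denominator1).
Definition local_add (x y : local_ring) : local_ring :=
  pr (frac_add (repr x) (repr y)).
Definition local_mul (x y : local_ring) : local_ring :=
  pr (frac_mul (repr x) (repr y)).
Definition local_opp (x : local_ring) : local_ring := pr (frac_opp (repr x)).

Lemma local_addE u v : local_add (pr u) (pr v) = pr (frac_add u v).
Proof.
apply/local_eqP; have [s es] := repr_local u; have [t et] := repr_local v.
exists (denominatorM s t); move: es et => /=.
move: (repr (pr u)) (repr (pr v)) => u' v' /=.
move: (val s) (val t) u.1 (val u.2) v.1 (val v.2) u'.1 (val u'.2) v'.1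
  (val v'.2) => {}s {}t a b c d a' b' c' d' es et.
have -> : s * t * ((a' * d' + c' * b') * (b * d)) =
  (s * (a' * b)) * (t * d' * d) + (t * (c' * d)) * (s * b' * b) by ring.
by rewrite es et; ring.
Qed.

Lemma local_mulE u v : local_mul (pr u) (pr v) = pr (frac_mul u v).
Proof.
apply/local_eqP; have [s es] := repr_local u; have [t et] := repr_local v.
exists (denominatorM s t); move: es et => /=.
move: (repr (pr u)) (repr (pr v)) => u' v' /=.
move: (val s) (val t) u.1 (val u.2) v.1 (val v.2) u'.1 (val u'.2) v'.1
  (val v'.2) => {}s {}t a b c d a' b' c' d' es et.
have -> : s * t * (a' * c' * (b * d)) = (s * (a' * b)) * (t * (c' * d))
  by ring.
by rewrite es et; ring.
Qed.

Lemma local_oppE u : local_opp (pr u) = pr (frac_opp u).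
Proof.
apply/local_eqP; have [s es] := repr_local u.
by exists s; rewrite /= !mulNr !mulrN es.
Qed.

Lemma local_eq_frac (u v : frac) :
  u.1 * val v.2 = v.1 * val u.2 -> pr u = pr v.
Proof. by move=> e; apply/local_eqP; exists denominator1; rewrite e. Qed.

Fact local_addA : associative local_add.
Proof.
move=> x y z; rewrite -[x]reprK -[y]reprK -[z]reprK.
rewrite (local_addE (repr x) (repr y)) (local_addE (repr y)) !local_addE.
by apply: local_eq_frac => /=; ring.
Qed.
Fact local_addC : commutative local_add.
Proof.
move=> x y; rewrite -[x]reprK -[y]reprK !local_addE.
by apply: local_eq_frac => /=; ring.
Qed.
Fact local_add0 : left_id local_zero local_add.
Proof.
move=> x; rewrite -[x]reprK local_addE.
by apply: local_eq_frac => /=; ring.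
Qed.
Fact local_addN : left_inverse local_zero local_opp local_add.
Proof.
move=> x; rewrite -[x]reprK (local_oppE (repr x)) local_addE.
by apply: local_eq_frac => /=; ring.
Qed.

HB.instance Definition _ := GRing.isZmodule.Build local_ring
  local_addA local_addC local_add0 local_addN.

Fact local_mulA : associative local_mul.
Proof.
move=> x y z; rewrite -[x]reprK -[y]reprK -[z]reprK.
rewrite (local_mulE (repr x) (repr y)) (local_mulE (repr y)) !local_mulE.
by apply: local_eq_frac => /=; ring.
Qed.
Fact local_mulC : commutative local_mul.
Proof.
move=> x y; rewrite -[x]reprK -[y]reprK !local_mulE.
by apply: local_eq_frac => /=; ring.
Qed.
Fact local_mul1 : left_id local_one local_mul.
Proof.
move=> x; rewrite -[x]reprK local_mulE.
by apply: local_eq_frac => /=; ring.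
Qed.
Fact local_mulDl : left_distributive local_mul local_add.
Proof.
move=> x y z; rewrite -[x]reprK -[y]reprK -[z]reprK.
rewrite (local_addE (repr x)) (local_mulE (repr x)) (local_mulE (repr y)).
rewrite local_mulE local_addE.
by apply: local_eq_frac => /=; ring.
Qed.

HB.instance Definition _ := GRing.Zmodule_isComPzRing.Build local_ring
  local_mulA local_mulC local_mul1 local_mulDl.

End LocalRing.

Definition nonreduced_points (X : comPzRingType) : set (Spec X) :=
  [set p | ~ reduced (local_ring p)].
Arguments nonreduced_points X : clear implicits.

(* Main.v *)
Require Import Defs.
From HB Require Import structures.
From mathcomp Require Import all_boot all_order all_algebra.
From mathcomp Require Import boolp classical_sets cardinality.
From mathcomp Require Import zify.

(** Write [L_k] for [lcs A k], [M_k] for [lcs_ideal A k], [X] for the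
    abelianization and [C_k] for the ideal of all [a] with [a * M_2] and
    [M_2 * a] contained in [M_k]. Everything follows from the fact that long
    words in the generators lie in [C_k] (long_words_in_conductor).

    Finiteness. [M_2] is spanned by the elements [u * [v, w]] with words [u],
    [v], [w], and such an element lies in [M_k] as soon as one of the words is
    long; hence [M_2] is finite-dimensional modulo [M_k], and so are all
    [N_j] with [j >= 2]. Likewise [L_3] is spanned by the [[u, [v, w]]]. If [v]
    or [w] is long, this lies in [[A, M_j]], and by the Jacobi identity the same
    holds if [u] is long. For odd [j] one has [[A, M_j] <= L_(j+1)]
    (comm_odd_ideal), so [L_3] is finite-dimensional modulo any [L_k]. The
    inclusion for odd [j] is an induction whose step is a symmetry argument: if
    one of the entries is in [L_(j-2)], then modulo [L_(j+1)] the expression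
    [[u, a * [d, [b, c]]]] alternates in [u], [a], [d], alternates in [b], [c]
    and satisfies a Bianchi identity, and in characteristic zero only zero has
    all these symmetries (alternating_bianchi).

    Long words. [M_2] is nilpotent modulo [M_k] (nil_lcs_ideal), so it suffices
    that each generator has a power in the ideal [C_k + M_2], which is
    homogeneous. Otherwise some homogeneous prime [P] of [X] contains it but not
    some [x] of degree one, and it remains to see that at such a prime all
    commutators are torsion modulo [M_k]; the Ore condition, valid because
    [A / M_k] is Lie nilpotent, then yields an element of [C_k] outside [P].

    The local statement. As [X] has dimension at most one, [P] is a minimal
    prime, and if [X] were not reduced at [P], it would not be reduced at the
    infinitely many primes containing [P] and some [x - d]. Hence the local ring
    at [P] is a field (local_ring_field). Again because the dimension is one,
    [X / P] is finite over the polynomials in [x]; so each generator [y] is a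
    root of a form [f] in [x] and [y] whose derivative [g] with respect to [y]
    is not in [P] (exists_relation, separable_relation): the field is
    generated over the rational functions in [x] by separable elements.
    Commuting the equation [f = 0] with an arbitrary [z] gives [g * [z, y] = 0]
    modulo [M_3] and the square of [M_2], which makes the localization of
    [A / M_3] commutative, and an induction extends this to [A / M_k]
    (local_commutative). Localizations are not constructed but described by
    the ideals that are saturated with respect to the complement of [P]. *)

Set Implicit Arguments.
Unset Strict Implicit.
Unset Printing Implicit Defensive.

Import GRing.Theory.
Local Open Scope classical_set_scope.
Local Open Scope ring_scope.

Local Notation span := Defs.span.
Local Arguments lcs {F} A k : simpl never.

(** * Subspaces *)

Section Submodules.
Variables (F : fieldType) (V : lmodType F).
Implicit Types (x y : V) (W S : set V).

Definition submodule W :=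
  W 0 /\ forall (k : F) x y, W x -> W y -> W (k *: x + y).

Lemma submoduleP W : submodule W <-> submod_closed [in W].
Proof.
split=> -[W0 Wl]; split; rewrite ?inE //.
- by move=> k x y; rewrite !inE; apply: Wl.
- exact/set_mem.
- by move=> k x y /mem_set ? /mem_set ?; apply/set_mem/Wl.
Qed.

Section Submodule.
Variable W : set V.
Hypothesis WP : submodule W.

Lemma submod0 : W 0. Proof. exact: WP.1. Qed.

Lemma submodD x y : W x -> W y -> W (x + y).
Proof. by move=> Wx Wy; rewrite -[x]scale1r; apply: WP.2. Qed.

Lemma submodZ k x : W x -> W (k *: x).
Proof. by move=> Wx; rewrite -[_ *: _]addr0; apply: WP.2 => //; apply: submod0. Qed.

Lemma submodN x : W x -> W (- x).
Proof. by rewrite -scaleN1r; apply: submodZ. Qed.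

Lemma submodB x y : W x -> W y -> W (x - y).
Proof. by move=> Wx /submodN; apply: submodD. Qed.

Lemma submod_sum (J : Type) (r : seq J) (P : pred J) (E : J -> V) :
  (forall i, P i -> W (E i)) -> W (\sum_(i <- r | P i) E i).
Proof. by move=> WE; apply: (big_ind W) => //; [apply: submod0|apply: submodD]. Qed.

End Submodule.

Lemma span_submodule S : submodule (span S : set V).
Proof. exact/submoduleP/span_submod_closed. Qed.

Lemma span_min S W : submodule W -> S `<=` W -> span S `<=` W.
Proof. by move=> /submoduleP; apply: smallest_sub. Qed.

Lemma sub_span (S : set V) : S `<=` span S.
Proof. exact: sub_gen_smallest. Qed.

Lemma span_mono (S S' : set V) : S `<=` S' -> span S `<=` span S'.
Proof.
move=> SS'; apply: span_min; first exact: span_submodule.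
by move=> x /SS'; apply: sub_span.
Qed.

End Submodules.

(** * Commutators and the lower central series *)

Section Commutators.
Variables (F : fieldType) (A : algType F).
Implicit Types (a b c x y : A) (W : set A).

Lemma commC a b : comm a b = - comm b a.
Proof. by rewrite /comm opprB. Qed.

Lemma commxx a : comm a a = 0.
Proof. exact: subrr. Qed.

Lemma commDr a b c : comm a (b + c) = comm a b + comm a c.
Proof. by rewrite /comm mulrDr mulrDl opprD addrACA. Qed.

Lemma commDl a b c : comm (a + b) c = comm a c + comm b c.
Proof. by rewrite commC commDr opprD -!commC. Qed.

Lemma commNr a b : comm a (- b) = - comm a b.
Proof. by rewrite /comm mulrN mulNr opprD. Qed.

Lemma commBr a b c : comm a (b - c) = comm a b - comm a c.
Proof. by rewrite commDr commNr. Qed.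

Lemma comm0r a : comm a 0 = 0.
Proof. by rewrite /comm mulr0 mul0r subrr. Qed.

Lemma commZr (k : F) a b : comm a (k *: b) = k *: comm a b.
Proof. by rewrite /comm -scalerAr -scalerAl -scalerBr. Qed.

Lemma commZl (k : F) a b : comm (k *: a) b = k *: comm a b.
Proof. by rewrite commC commZr -scalerN -commC. Qed.

Lemma comm1r a : comm a 1 = 0.
Proof. by rewrite /comm mulr1 mul1r subrr. Qed.

Lemma commMr a b c : comm a (b * c) = comm a b * c + b * comm a c.
Proof. by rewrite /comm mulrBl mulrBr !mulrA addrA subrK. Qed.

Lemma commMl a b c : comm (a * b) c = a * comm b c + comm a c * b.
Proof. by rewrite commC commMr opprD addrC -mulrN -mulNr -!commC. Qed.

Lemma comm_jacobi a b c :
  comm a (comm b c) = comm (comm a b) c + comm b (comm a c).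
Proof.
by rewrite [comm b c]/comm commBr !commMr [X in _ - X]addrC opprD addrACA.
Qed.

Lemma mul_commE a b : a * b = b * a + comm a b.
Proof. by rewrite /comm addrC subrK. Qed.

Lemma lcs_submodule k : submodule (lcs A k).
Proof. exact/submoduleP/lcs_submod_closed. Qed.

Lemma lcs_step k a b : lcs A k b -> lcs A k.+1 (comm a b).
Proof. by case: k => [//|k] lb; apply: sub_span; exists a, b. Qed.

Lemma lcs_min k W : submodule W ->
  (forall a b, lcs A k.+1 b -> W (comm a b)) -> lcs A k.+2 `<=` W.
Proof. by move=> WP WS; apply: span_min => // _ [a [b [lb ->]]]; apply: WS. Qed.

Lemma lcs_le i j : (i <= j)%N -> lcs A j `<=` lcs A i.
Proof.
move=> /subnK <-; elim: (j - i)%N => [//|n IH].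
by apply: subset_trans IH; apply: lcsS.
Qed.

Lemma lcs2 a b : lcs A 2 (comm a b).
Proof. exact: lcs_step. Qed.

(** The lower central series is a filtration of the Lie algebra: by the Jacobi
    identity the weight of the first entry can be moved to the second. *)
Lemma lcs_comm i j x y :
  lcs A i.+1 x -> lcs A j.+1 y -> lcs A (i + j).+2 (comm x y).
Proof.
elim: i j x y => [|i IH] j x y; first by move=> _ ly; apply: lcs_step.
move=> lx ly; move: x lx.
apply: (@lcs_min _ [set x | lcs A (i.+1 + j).+2 (comm x y)]) => [|a b lb] /=.
  split=> [|k u v lu lv] /=; first by rewrite commC comm0r oppr0;
    exact: (submod0 (lcs_submodule _)).
  by rewrite commDl commZl; apply: (lcs_submodule _).2.
have -> : comm (comm a b) y = comm a (comm b y) - comm b (comm a y).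
  by rewrite comm_jacobi addrK.
apply: (submodB (lcs_submodule _)).
  by apply: lcs_step; apply: IH.
by rewrite addSnnS; apply: IH => //; apply: lcs_step.
Qed.

End Commutators.

Arguments lcs_submodule {F A} k.

(** * Two-sided ideals *)

Section Ideals.
Variables (F : fieldType) (A : algType F).
Implicit Types (a b c x y z s : A) (I T G : set A).

Section OneIdeal.
Variable I : set A.
Hypothesis II : two_sided_ideal I.

Lemma ideal0 : I 0. Proof. by case: II. Qed.

Lemma idealD x y : I x -> I y -> I (x + y).
Proof. by case: II => _ ID _; apply: ID. Qed.

Lemma idealMl a x : I x -> I (a * x).
Proof. by case: II => _ _ IM /(IM a)[]. Qed.

Lemma idealMr a x : I x -> I (x * a).
Proof. by case: II => _ _ IM /(IM a)[]. Qed.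

Lemma idealZ (k : F) x : I x -> I (k *: x).
Proof. by move=> Ix; rewrite -[x]mul1r scalerAl; apply: idealMl. Qed.

Lemma ideal_submodule : submodule I.
Proof. by split=> [|k x y Ix Iy]; [exact: ideal0|apply: idealD => //;
  apply: idealZ]. Qed.

Lemma idealN x : I x -> I (- x).
Proof. by move=> Ix; apply: (submodN ideal_submodule). Qed.

Lemma idealB x y : I x -> I y -> I (x - y).
Proof. by move=> Ix Iy; apply: (submodB ideal_submodule). Qed.

Lemma ideal_comm a x : I x -> I (comm a x).
Proof. by move=> Ix; apply: idealB; [apply: idealMl|apply: idealMr]. Qed.

Lemma ideal_sub x y : I (x - y) -> I y -> I x.
Proof. by move=> Ixy Iy; rewrite -(subrK y x); apply: idealD. Qed.

Lemma ideal_subl x y : I (x - y) -> I x -> I y.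
Proof. by move=> Ixy Ix; rewrite -(subKr x y); apply: idealB. Qed.

End OneIdeal.

Definition ideal_gen G : set A := smallest (@two_sided_ideal A) G.

Lemma ideal_gen_two_sided G : two_sided_ideal (ideal_gen G).
Proof.
split=> [I [[]]//|x y Ix Iy I II|a x Ix].
  by apply: (idealD II.1); [apply: Ix|apply: Iy].
by split=> I II; [apply: (idealMl II.1)|apply: (idealMr II.1)]; apply: Ix.
Qed.

Lemma ideal_gen_min G I : two_sided_ideal I -> G `<=` I -> ideal_gen G `<=` I.
Proof. exact: smallest_sub. Qed.

Lemma sub_ideal_gen G : G `<=` ideal_gen G.
Proof. exact: sub_gen_smallest. Qed.

Lemma ideal_gen_mono G G' : G `<=` ideal_gen G' -> ideal_gen G `<=` ideal_gen G'.
Proof. by apply: ideal_gen_min; apply: ideal_gen_two_sided. Qed.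

Lemma lcs_idealP k : two_sided_ideal (lcs_ideal A k).
Proof. exact: lcs_ideal_two_sided. Qed.

Lemma lcs_sub_ideal k : lcs A k `<=` lcs_ideal A k.
Proof. exact: sub_gen_smallest. Qed.

Lemma lcs_ideal_min k I :
  two_sided_ideal I -> lcs A k `<=` I -> lcs_ideal A k `<=` I.
Proof. exact: smallest_sub. Qed.

Lemma lcs_ideal_le i j : (i <= j)%N -> lcs_ideal A j `<=` lcs_ideal A i.
Proof.
move=> ij; apply: lcs_ideal_min; first exact: lcs_idealP.
by move=> x /(lcs_le ij); apply: lcs_sub_ideal.
Qed.

Lemma comm_lcs_ideal2 a b : lcs_ideal A 2 (comm a b).
Proof. by apply: lcs_sub_ideal; apply: lcs2. Qed.

Lemma lcs_ideal2_min I : two_sided_ideal I -> (forall a b, I (comm a b)) ->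
  lcs_ideal A 2 `<=` I.
Proof.
move=> II Ic; apply: lcs_ideal_min => //; apply: lcs_min => [|a b _ //].
exact: ideal_submodule.
Qed.

Lemma lcs_ideal3_min I : two_sided_ideal I ->
  (forall a b c, I (comm a (comm b c))) -> lcs_ideal A 3 `<=` I.
Proof.
move=> II Ic; apply: lcs_ideal_min => //; apply: lcs_min;
  first exact: ideal_submodule.
move=> a b; move: b; apply: (@lcs_min _ _ _ [set b | I (comm a b)]) => [|b c _];
  last exact: Ic.
split=> /= [|k u v Iu Iv]; first by rewrite comm0r; apply: ideal0.
by rewrite commDr commZr; apply: (ideal_submodule II).2.
Qed.

(** As [l * a = a * l + [l, a]], a left ideal generated by a Lie ideal is
    two-sided. *)
Lemma lcs_ideal_span k :
  lcs_ideal A k `<=` span [set x | exists a l, lcs A k l /\ x = a * l].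
Proof.
set G := (X in span X); have GP := span_submodule G.
apply: lcs_ideal_min => [|l lk]; last by apply: sub_span; exists 1, l;
  rewrite mul1r.
split=> [|x y|a x]; [exact: submod0|exact: submodD|].
move: x; apply: (@span_min _ _ _ [set x | _ /\ _]) => [|_ [b [l [lk ->]]]].
  split=> [|c u v [au ua] [av va]] /=.
    by rewrite mulr0 mul0r; split; apply: submod0.
  by rewrite mulrDr mulrDl -scalerAr -scalerAl; split; apply: GP.2.
split; first by apply: sub_span; exists (a * b), l; rewrite mulrA.
rewrite -mulrA (mul_commE l) mulrDr mulrA; apply: (submodD GP).
  by apply: sub_span; exists (b * a), l.
apply: sub_span; exists b, (comm l a); split=> //; rewrite commC.
by apply: (submodN (lcs_submodule k)); apply/lcsS; apply: lcs_step.
Qed.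

End Ideals.

Arguments lcs_idealP {F A} k.

(** * Commutators with the ideals of odd index *)

Lemma lmod_rat_torsion (V : lmodType rat) n (x : V) : x *+ n.+1 = 0 -> x = 0.
Proof. by rewrite -scaler_nat => /eqP;
  rewrite scaler_eq0 Num.Theory.pnatr_eq0 => /eqP. Qed.

Section AlternatingBianchi.
Variables (V : lmodType rat) (I : eqType) (D : seq I -> Prop).
Variable T : I -> I -> I -> I -> I -> V.
Hypothesis Dperm : forall s t, perm_eq s t -> D s -> D t.
Hypothesis T12 : forall u a d b c, D [:: u; a; d; b; c] ->
  T u a d b c = - T a u d b c.
Hypothesis T23 : forall u a d b c, D [:: u; a; d; b; c] ->
  T u a d b c = - T u d a b c.
Hypothesis T45 : forall u a d b c, D [:: u; a; d; b; c] ->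
  T u a d b c = - T u a d c b.
Hypothesis Tbianchi : forall u a d b c, D [:: u; a; d; b; c] ->
  T u a d b c + T u a b c d + T u a c d b = 0.

Local Ltac perm5 h :=
  by (apply: Dperm h; apply/permP => f /=; lia).

(** For fixed [u] the symmetries of [T] are those of a curvature tensor. *)
Lemma bianchi_pair_symmetry u a d b c : D [:: u; a; d; b; c] ->
  T u a d b c = T u b c a d.
Proof.
move=> h.
pose x1 := T u a d b c; pose x2 := T u a b c d; pose x3 := T u a c d b.
pose y1 := T u b c a d; pose y2 := T u c d a b; pose y3 := T u d b a c.
have bianchi p q r s : D [:: u; p; q; r; s] ->
    T u p q r s = - (T u p r s q + T u p s q r).
  by move/Tbianchi/eqP; rewrite -addrA addr_eq0 => /eqP.
have B1 : x1 = - (x2 + x3) by apply: bianchi.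
have B2 : x1 = - (y2 + y3).
  rewrite /x1 (@T23 u a d b c) // (@bianchi d a b c); last by perm5 h.
  rewrite (@T45 u d b c a); last by perm5 h.
  rewrite (@T23 u d c a b); last by perm5 h.
  by rewrite -opprD opprK addrC opprD.
have B3 : y1 = - (x2 + y3).
  rewrite /y1 (@bianchi b c a d); last by perm5 h.
  rewrite (@T23 u b a d c) ?(@T45 u a b d c) ?opprK; [|perm5 h..].
  by rewrite (@T23 u b d c a) ?(@T45 u d b c a) ?opprK; [|perm5 h..].
have B4 : y1 = - (x3 + y2).
  rewrite /y1 (@T23 u b c a d); last by perm5 h.
  rewrite (@bianchi c b a d); last by perm5 h.
  rewrite (@T23 u c a d b); last by perm5 h.
  rewrite (@T45 u c d b a); last by perm5 h.
  by rewrite -opprD opprK opprD.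
apply/eqP; rewrite -subr_eq0; apply/eqP; apply: (@lmod_rat_torsion _ 1).
rewrite -/x1 -/y1 mulrnBl !mulr2n {1}B1 {1}B2 {1}B3 {1}B4 -!opprD.
by rewrite [y2 + y3]addrC (addrACA x2 x3) subrr oppr0.
Qed.

(** Rotating the first three arguments and exchanging pairs also permutes the
    last two arguments with the third, so that the Bianchi identity says that
    three times [T] vanishes. *)
Lemma alternating_bianchi u a d b c : D [:: u; a; d; b; c] ->
  T u a d b c = 0.
Proof.
have rot x y z p q : D [:: x; y; z; p; q] -> T x y z p q = T z x y p q.
  by move=> h; rewrite (@T23 x y z p q) // (@T12 x z y p q) ?opprK //; perm5 h.
have shift x y z p q : D [:: x; y; z; p; q] -> T x y z p q = T x y p q z.
  move=> h; rewrite (@bianchi_pair_symmetry x y z p q) //.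
  rewrite (@rot x p q y z); last by perm5 h.
  rewrite (@bianchi_pair_symmetry q x p y z); last by perm5 h.
  rewrite -(@rot y z q x p); last by perm5 h.
  rewrite (@bianchi_pair_symmetry y z q x p); last by perm5 h.
  rewrite (@T12 y x p z q) ?(@T45 x y p z q) ?opprK //; perm5 h.
move=> h; apply: (@lmod_rat_torsion _ 2).
rewrite !mulrS mulr0n addr0 addrA {2}(@shift u a d b c) //.
rewrite -[X in _ + _ + X](@shift u a c d b); last by perm5 h.
exact: Tbianchi.
Qed.

End AlternatingBianchi.

Section QuotientProjection.
Variables (R : pzRingType) (V : lmodType R) (W : subspace V).

Definition quot_pi (x : V) : quot_mod W := \pi_(quot_mod W)%qT x.

Lemma quot_piD x y : quot_pi (x + y) = quot_pi x + quot_pi y.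
Proof. exact: quot_modD. Qed.

Lemma quot_pi_eq0 x : quot_pi x = 0 <-> subspace_set W x.
Proof.
have pi0 : quot_pi 0 = 0.
  by apply: (@addrI _ (quot_pi 0)); rewrite -quot_piD !addr0.
rewrite -pi0; split=> [/(@quot_mod_eqP _ _ W)|Wx];
  first by rewrite subr0 => /set_mem.
by apply/(@quot_mod_eqP _ _ W); rewrite subr0; apply/mem_set.
Qed.

Lemma quot_piN x y : subspace_set W (x + y) -> quot_pi x = - quot_pi y.
Proof. by move=> /quot_pi_eq0/eqP; rewrite quot_piD addr_eq0 => /eqP. Qed.

End QuotientProjection.

Section OddIdeals.
Variable A : algType rat.

Section Step.
Variable m : nat.
Hypothesis Hm : forall u x : A, lcs_ideal A m.+1 x -> lcs A m.+2 (comm u x).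

(** The Jacobi induction of [lcs_comm] started from the hypothesis on [M_m+1]. *)
Lemma lcs_comm_ideal i y x :
  lcs A i.+1 y -> lcs_ideal A m.+1 x -> lcs A (i + m).+2 (comm y x).
Proof.
move=> ly Mx; elim: i y ly => [|i IH] y; first by move=> _; apply: Hm.
move: y; apply: (@lcs_min _ _ _ [set y | lcs A (i.+1 + m).+2 (comm y x)]).
  split=> [|k u v lu lv] /=.
    by rewrite commC comm0r oppr0; apply: (submod0 (lcs_submodule _)).
  by rewrite commDl commZl; apply: (lcs_submodule _).2.
move=> a b lb /=.
have -> : comm (comm a b) x = comm a (comm b x) - comm b (comm a x).
  by rewrite comm_jacobi addrK.
apply: (submodB (lcs_submodule _)); first by apply: lcs_step; apply: IH.
by rewrite addSnnS; apply: lcs_comm => //; apply: Hm.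
Qed.

(** Elements carry a weight, here shifted by one so that an arbitrary element
    has weight [0] and an element of [lcs A m.+1] has weight [m]. *)
Definition weighted (p : A * nat) : Prop :=
  lcs A p.2.+1 p.1 /\ (p.2 = 0 \/ p.2 = m)%N.

(** At most one of the two weights is nonzero, so that the product lies in the
    ideal [M_m+1] if its weight is [m]. *)
Lemma weighted_mul p q i y : weighted p -> weighted q ->
  (p.2 + q.2 <= m)%N -> lcs A i.+1 y ->
  lcs A (i + (p.2 + q.2)).+2 (comm y (p.1 * q.1)).
Proof.
case: p q => [p v] [q w] [/= lp hv] [/= lq hw] le ly.
have MP := lcs_idealP (A := A) m.+1.
have [v0|v0] := eqVneq v 0%N; last first.
  have [-> ->] : v = m /\ w = 0%N by lia.
  rewrite addn0; apply: lcs_comm_ideal => //; apply: (idealMr MP).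
  by apply: lcs_sub_ideal; have <- : v = m by lia.
have [w0|w0] := eqVneq w 0%N; first by rewrite v0 w0; apply: lcs_comm.
have ew : w = m by lia.
rewrite v0 add0n ew; apply: lcs_comm_ideal => //; apply: (idealMl MP).
by apply: lcs_sub_ideal; rewrite -ew.
Qed.

Definition weighted_list (s : seq (A * nat)) : Prop :=
  (forall p, p \in s -> weighted p) /\ sumn [seq p.2 | p <- s] = m.

Definition nested (u a d b c : A * nat) : quot_mod (lcs_subspace A m.+4) :=
  quot_pi (lcs_subspace A m.+4)
    (comm u.1 (a.1 * comm d.1 (comm b.1 c.1))).

(** [nested] is multilinear and vanishes on products of weights that are too
    large, so it inherits from the Leibniz rule the symmetries which force it
    to vanish altogether. *)
Lemma nested_eq0 u a d b c : weighted_list [:: u; a; d; b; c] ->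
  nested u a d b c = 0.
Proof.
have unfold_list x y z p q : weighted_list [:: x; y; z; p; q] ->
    [/\ weighted x, weighted y, weighted z, weighted p & weighted q] /\
    (x.2 + (y.2 + (z.2 + (p.2 + q.2))) = m)%N.
  move=> [w /= e]; split; last by rewrite -[RHS]e addn0.
  by split; apply: w; rewrite !inE eqxx ?orbT.
apply: alternating_bianchi =>
  {u a d b c} [s t st [ws e]|u a d b c|u a d b c|u a d b c|u a d b c].
- split; first by move=> p; rewrite -(perm_mem st); apply: ws.
  by rewrite -[RHS]e; apply/esym/perm_sumn/perm_map.
- move: u a d b c => [u i] [a j] [d k] [b p] [c q].
  move=> /unfold_list[[wu wa [/= ld _] [/= lb _] [/= lc _]] /= e].
  apply: quot_piN => /=; set l := comm d _.
  have ll : lcs A (k + (p + q).+1).+2 l by apply: lcs_comm => //; apply: lcs_comm.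
  have -> : comm u (a * l) + comm a (u * l) =
      comm a (comm u l) - comm l (u * a).
    rewrite -commC !commMr commMl [comm a (comm _ _)]/comm.
    rewrite addrACA [comm a u]commC mulNr subrr add0r.
    by rewrite addrA addrAC subrK.
  apply: (submodB (lcs_submodule _)).
    have := lcs_comm wa.1 (lcs_comm wu.1 ll).
    by apply: lcs_le => /=; lia.
  have := @weighted_mul (u, i) (a, j) _ _ wu wa ltac:(move=> /=; lia) ll.
  by apply: lcs_le => /=; lia.
- move: u a d b c => [u i] [a j] [d k] [b p] [c q].
  move=> /unfold_list[[[/= lu _] wa wd [/= lb _] [/= lc _]] /= e].
  apply: quot_piN => /=; rewrite -commDr; set l := comm b _.
  have ll : lcs A (p + q).+2 l by apply: lcs_comm.
  have -> : a * comm d l + d * comm a l =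
      comm d (comm a l) - comm l (a * d).
    rewrite -commC commMl [comm d (comm _ _)]/comm.
    by rewrite [a * _ + comm a l * d]addrC addrA subrK addrC.
  rewrite commBr; apply: (submodB (lcs_submodule _)).
    have := lcs_comm lu (lcs_comm wd.1 (lcs_comm wa.1 ll)).
    by apply: lcs_le => /=; lia.
  have := lcs_comm lu (@weighted_mul (a, j) (d, k) _ _ wa wd ltac:(move=> /=;
    lia) ll).
  by apply: lcs_le => /=; lia.
- move=> _; apply: quot_piN => /=; rewrite -commDr -mulrDr -commDr.
  rewrite [comm c.1 _]commC subrr comm0r mulr0 comm0r.
  exact: (submod0 (lcs_submodule _)).
- move=> _; rewrite /nested -!quot_piD; apply/quot_pi_eq0 => /=.
  rewrite -!commDr -!mulrDr comm_jacobi [comm (comm _ _) _]commC.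
  rewrite [comm d.1 c.1]commC commNr subrK.
  by rewrite addNr mulr0 comm0r; apply: (submod0 (lcs_submodule _)).
Qed.

End Step.

(** Induction on [j]: the entry [c] of an element [a * [d, [b, c]]] of the next
    ideal of odd index is taken in the lower central series at the previous odd
    index. *)
Lemma comm_odd_ideal j (u x : A) :
  lcs_ideal A j.*2.+1 x -> lcs A j.*2.+2 (comm u x).
Proof.
elim: j u x => [|j IH] u x; first by move=> _; apply: lcs2.
rewrite doubleS; set m := j.*2 => /lcs_ideal_span.
apply: (@span_min _ _ _ [set x | lcs A m.+4 (comm u x)]) x => [|_ [a [l [lm ->]]]].
  split=> [|k x y lx ly] /=; first by rewrite comm0r;
    apply: (submod0 (lcs_submodule _)).
  by rewrite commDr commZr; apply: (lcs_submodule _).2.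
move: l lm; apply: (@lcs_min _ _ _ [set l | lcs A m.+4 (comm u (a * l))]).
  split=> [|k x y lx ly] /=; first by rewrite mulr0 comm0r;
    apply: (submod0 (lcs_submodule _)).
  by rewrite mulrDr commDr -scalerAr commZr; apply: (lcs_submodule _).2.
move=> d; apply: (@lcs_min _ _ _ [set l | lcs A m.+4 (comm u (a * comm d l))]).
  split=> [|k x y lx ly] /=; first by rewrite comm0r mulr0 comm0r;
    apply: (submod0 (lcs_submodule _)).
  by rewrite commDr mulrDr commDr commZr -scalerAr commZr;
    apply: (lcs_submodule _).2.
move=> b c lc /=.
have := @nested_eq0 m IH (u, 0) (a, 0) (d, 0) (b, 0) (c, m).
move/(_ _)/quot_pi_eq0; apply; split=> [p|]; last by rewrite /= !add0n addn0.
by rewrite !inE => /or4P[||| /orP[]] /eqP-> ; split=> //=; by [left|right].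
Qed.

End OddIdeals.

(** * Saturated ideals *)

Section Saturation.
Variables (F : fieldType) (A : algType F).
Implicit Types (a b c x y z s u v : A) (I T G S J : set A).

(** Modulo a saturated ideal the elements of [S] are regular from the left; these
    ideals replace the ideals of the localization at [S]. *)
Definition saturated S I : Prop :=
  two_sided_ideal I /\ forall s x, S s -> I (s * x) -> I x.

Definition sat_gen S G : set A := smallest (saturated S) G.

Lemma sat_gen_saturated S G : saturated S (sat_gen S G).
Proof.
split=> [|s x Ss Isx I II]; last by apply: (II.1.2 s) => //; apply: Isx.
split=> [I [[[]]]//|x y Ix Iy I II|a x Ix].
  by apply: (idealD II.1.1); [apply: Ix|apply: Iy].
by split=> I II; [apply: (idealMl II.1.1)|apply: (idealMr II.1.1)]; apply: Ix.
Qed.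

Lemma sat_gen_min S G I : saturated S I -> G `<=` I -> sat_gen S G `<=` I.
Proof. exact: smallest_sub. Qed.

Lemma sub_sat_gen S G : G `<=` sat_gen S G.
Proof. exact: sub_gen_smallest. Qed.

Lemma saturated_set0 I : two_sided_ideal I -> saturated set0 I.
Proof. by move=> II; split=> // s x []. Qed.

(** The elements that an element of [G] multiplies into [T] form a saturated
    ideal because [G] is central modulo [T]. So do the elements that multiply the
    whole generated ideal into [T], and both contain [T] and [G]. *)
Lemma sat_gen_mul0 S T G : saturated S T ->
    (forall z g, G g -> T (comm z g)) ->
    (forall g h, G g -> G h -> T (g * h)) ->
  forall u v, sat_gen S (T `|` G) u -> sat_gen S (T `|` G) v -> T (u * v).
Proof.
move=> [TP Ts] Gc G0.
have Tg g v : G g -> sat_gen S (T `|` G) v -> T (g * v).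
  move=> Gg; move: v; have swap a v : T (g * (a * v)) <-> T (a * (g * v)).
    have e : g * (a * v) = a * (g * v) - comm a g * v.
      by rewrite /comm mulrBl !mulrA opprB addrC subrK.
    have Tc : T (comm a g * v) by apply: (idealMr TP); apply: Gc.
    by rewrite e; split=> [|?]; [move/(ideal_sub TP); apply|apply: (idealB TP)].
  apply: (@sat_gen_min _ _ [set v | T (g * v)]) => [|v [Tv|Gv]] /=.
  - split=> [|s x Ss /= /swap]; last exact: Ts.
    split=> [|x y|a x] /=; first by rewrite mulr0; apply: (ideal0 TP).
      by rewrite mulrDr; apply: (idealD TP).
    by move=> Tx; split; [apply/swap/(idealMl TP)|rewrite mulrA;
      apply: (idealMr TP)].
  - exact: (idealMl TP).
  - exact: G0.
move=> u v Iu; move: u Iu v.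
apply: (@sat_gen_min _ _ [set u | forall v, _ -> T (u * v)]) =>
  [|u [Tu|Gu] v Iv] /=.
- split=> [|s x Ss /= h v Iv]; last by apply: (Ts s) => //; rewrite mulrA; apply: h.
  split=> [|x y hx hy|a x hx] /=; first by move=> v _; rewrite mul0r;
    apply: (ideal0 TP).
    by move=> v Iv; rewrite mulrDl; apply: (idealD TP); [apply: hx|apply: hy].
  split=> v Iv; rewrite -mulrA; first by apply: (idealMl TP); apply: hx.
  by apply: hx; apply: (idealMl (sat_gen_saturated S _).1).
- exact: (idealMr TP).
- exact: Tg.
Qed.

(** * Nilpotency of the commutator ideal *)

Lemma comm3_ideal T : lcs_ideal A 3 `<=` T -> forall a b c, T (comm a (comm b c)).
Proof.
by move=> T3 a b c; apply: T3; apply: lcs_sub_ideal; apply: lcs_step; apply: lcs2.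
Qed.

(** The Leibniz rule expands [[a, [b, a * d]]], which is in [M_3], into
    [[b, a] * [a, d]] and two multiples of elements of [M_3]. *)
Lemma comm_mul_comm T : two_sided_ideal T -> lcs_ideal A 3 `<=` T ->
  forall a b d, T (comm a b * comm a d).
Proof.
move=> TP /comm3_ideal T3 a b d.
have := T3 a b (a * d); rewrite commMr !commDr !commMr commxx mul0r add0r.
move=> /(idealB TP)/(_ (idealMl TP a (T3 a b d))).
rewrite addrK => /(idealB TP)/(_ (idealMr TP d (T3 a b a))).
by rewrite addrC addrA addNr add0r [comm b a]commC mulNr => /(idealN TP);
  rewrite opprK.
Qed.

Definition nil_mod I T n : Prop := forall s : seq A,
  size s = n -> (forall x, x \in s -> I x) -> T (\prod_(x <- s) x).

Lemma nil_mod_double I I' T n : nil_mod I I' n ->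
  (forall u v, I' u -> I' v -> T (u * v)) -> nil_mod I T (n + n).
Proof.
move=> In I'T s sn sI; rewrite -(cat_take_drop n s) big_cat; apply: I'T; apply: In.
- by rewrite size_takel // sn leq_addr.
- by move=> x /mem_take; apply: sI.
- by rewrite size_drop sn addnK.
- by move=> x /mem_drop; apply: sI.
Qed.

(** Adjoining one central element of square zero doubles the exponent. *)
Lemma nil_adjoin (cs : seq A) T : two_sided_ideal T ->
    (forall c, c \in cs -> T (c * c) /\ forall z, T (comm z c)) ->
  exists n, nil_mod (ideal_gen (T `|` [set` cs])) T n.
Proof.
elim: cs T => [|c cs IH] T TP csT.
  exists 1%N => -[|x []]// _ sI; rewrite big_seq1.
  have: ideal_gen (T `|` [set` [::]]) x by apply: sI; rewrite inE.
  by apply: ideal_gen_min => // y [].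
have [Tcc Tc] := csT c (mem_head _ _).
pose T' := sat_gen set0 (T `|` [set c]).
have T'P : two_sided_ideal T' by case: (sat_gen_saturated set0 (T `|` [set c])).
have TT' : T `<=` T' by move=> x Tx; apply: sub_sat_gen; left.
have [|n nI] := IH T' T'P.
  move=> d dcs; have [|Tdd Td] := csT d; first by rewrite inE dcs orbT.
  by split=> [|z]; apply: TT'.
exists (n + n)%N; apply: (@nil_mod_double _ T').
  move=> s sn sI; apply: nI => // x /sI; apply: ideal_gen_mono => {}x [Tx|/=].
    by apply: sub_ideal_gen; left; apply: TT'.
  rewrite inE => /predU1P[->|xcs]; apply: sub_ideal_gen; last by right.
  by left; apply: sub_sat_gen; right.
apply: sat_gen_mul0; first exact: saturated_set0.
- by move=> z _ ->.
- by move=> _ _ -> ->.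
Qed.

Lemma generates_ind S (C : set A) : generates S -> submodule C -> C 1 ->
  (forall x y, C x -> C y -> C (x * y)) -> S `<=` C -> forall x, C x.
Proof.
move=> gS [C0 Cl] C1 CM SC x; have: setT x by [].
rewrite -gS; apply: smallest_sub => //; split; rewrite ?inE //.
- by move=> k u v; rewrite !inE; apply: Cl.
- by move=> u v; rewrite !inE; apply: CM.
Qed.

Lemma centralizer_mod S I c : generates S -> two_sided_ideal I ->
  (forall y, S y -> I (comm c y)) -> forall x, I (comm c x).
Proof.
move=> gS IP h; apply: (@generates_ind S [set x | I (comm c x)]) => //=.
- split=> [|k u v Iu Iv] /=; first by rewrite comm0r; apply: (ideal0 IP).
  by rewrite commDr commZr; apply: (ideal_submodule IP).2.
- by rewrite comm1r; apply: (ideal0 IP).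
- move=> x y Ix Iy; rewrite commMr.
  by apply: (idealD IP); [apply: (idealMr IP)|apply: (idealMl IP)].
Qed.

Lemma commutative_mod S I : generates S -> two_sided_ideal I ->
  (forall x y, S x -> S y -> I (comm x y)) -> forall a b, I (comm a b).
Proof.
move=> gS IP h a; apply: (centralizer_mod gS IP) => y Sy.
rewrite commC; apply: (idealN IP); move: a.
by apply: (centralizer_mod gS IP) => z Sz; apply: h.
Qed.

(** Because [M_2] is finitely generated modulo [M_3] by central elements of
    square zero, it is nilpotent modulo [M_3]. *)
Lemma nil_lcs_ideal3 (Y : seq A) : generates [set` Y] ->
  exists n, nil_mod (lcs_ideal A 2) (lcs_ideal A 3) n.
Proof.
move=> gY; have M3P := lcs_idealP (A := A) 3.
have [|n nM] := @nil_adjoin [seq comm x y | x <- Y, y <- Y] _ M3P.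
  move=> _ /allpairsP[[x y] [/= _ _ ->]]; split; first exact: comm_mul_comm.
  by move=> z; apply: comm3_ideal.
exists n => s sn sM; apply: nM => // x /sM; apply: lcs_ideal2_min.
  exact: ideal_gen_two_sided.
apply: (commutative_mod gY); first exact: ideal_gen_two_sided.
move=> y z Yy Yz; apply: sub_ideal_gen; right => /=.
by apply/allpairsP; exists (y, z).
Qed.

(** For [l = [b, l1]] and [l' = [c, l2]] in [L_k], commuting [[l2 * b, l1]] with
    [c] shows that [l * l'] equals, up to sign and modulo [M_k+1], a product with
    the factor [[l2, l1]], which has weight [2 (k - 1) > k]. *)
Lemma lcs_mul k x y : lcs A k.+3 x -> lcs A k.+3 y -> lcs_ideal A k.+4 (x * y).
Proof.
move=> + ly; move: x; set M := lcs_ideal A k.+4;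
  have MP : two_sided_ideal M by apply: lcs_idealP.
apply: (@lcs_min _ _ _ [set x | M (x * y)]) => [|b l1 lb /=].
  split=> [|j u v Mu Mv] /=; first by rewrite mul0r; apply: (ideal0 MP).
  by rewrite mulrDl -scalerAl; apply: (ideal_submodule MP).2.
move: y ly; apply: (@lcs_min _ _ _ [set y | M (comm b l1 * y)]) => [|c l2 lc /=].
  split=> [|j u v Mu Mv] /=; first by rewrite mulr0; apply: (ideal0 MP).
  by rewrite mulrDr -scalerAr; apply: (ideal_submodule MP).2.
have Mc z l : lcs A k.+3 l -> M (comm z l) by move=> lk; apply: lcs_sub_ideal;
  apply: lcs_step.
have Ml : M (comm l2 l1).
  by apply: lcs_sub_ideal; apply: lcs_le (lcs_comm lc lb); rewrite !addSn !addnS;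
    lia.
have := Mc c _ (lcs_step (l2 * b) lb).
rewrite commMl commDr (commMr c l2) -addrA => Mtot.
have Mcx : M (comm c l2 * comm b l1).
  rewrite -[_ * _](addrK (l2 * comm c (comm b l1) + comm c (comm l2 l1 * b))).
  apply: (idealB MP) => //; apply: (idealD MP); first by apply: (idealMl MP);
    apply: Mc; apply: lcs_step.
  by apply: (ideal_comm MP); apply: (idealMr MP).
rewrite mul_commE; apply: (idealD MP) => //.
by apply: Mc; apply: lcs_step.
Qed.

Lemma lcs_ideal_mul k x y :
  lcs_ideal A k.+3 x -> lcs_ideal A k.+3 y -> lcs_ideal A k.+4 (x * y).
Proof.
have MP := lcs_idealP (A := A) k.+4.
have sub : lcs_ideal A k.+3 `<=` sat_gen set0 (lcs_ideal A k.+4 `|` lcs A k.+3).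
  apply: lcs_ideal_min;
    first by case: (sat_gen_saturated set0 (lcs_ideal A k.+4 `|` lcs A k.+3)).
  by move=> z lz; apply: sub_sat_gen; right.
move=> /sub Mx /sub My; move: Mx My; apply: sat_gen_mul0;
  first exact: saturated_set0.
- by move=> z g lg; apply: lcs_sub_ideal; apply: lcs_step.
- exact: lcs_mul.
Qed.

Lemma nil_lcs_ideal (Y : seq A) k : generates [set` Y] ->
  exists n, nil_mod (lcs_ideal A 2) (lcs_ideal A k) n.
Proof.
move=> gY; have [n nM] : exists n, nil_mod (lcs_ideal A 2) (lcs_ideal A k.+3) n.
  elim: k => [|k [n nM]]; first exact: nil_lcs_ideal3 gY.
  by exists (n + n)%N; apply: nil_mod_double nM _; apply: lcs_ideal_mul.
by exists n => s sn sM; apply: lcs_ideal_le (nM s sn sM); lia.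
Qed.

(** * Local commutativity *)

Section Local.
Variables (S : set A) (Y : seq A) (x : A).
Hypothesis gY : generates [set` Y].

(** [f] plays the role of an equation of [y] over [x] that holds after inverting
    [S], and [g] that of its derivative with respect to [y]. *)
Definition unramified_over y : Prop := exists f g s,
  [/\ S g, S s, lcs_ideal A 2 (s * f) &
      forall J z, two_sided_ideal J -> lcs_ideal A 3 `<=` J -> J (comm z x) ->
        J (comm z f - g * comm z y)].

Hypothesis unr : forall y, y \in Y -> unramified_over y.

(** Commuting the equation [f] with [z] gives [[z, y]] in the saturated ideal
    generated by [T] and the square of [M_2]. Hence [M_2] lies in that ideal, and
    in [T] since [M_2] is nilpotent modulo [T]. *)
Lemma local_commutative3 T : saturated S T -> lcs_ideal A 3 `<=` T ->
  forall a b, T (comm a b).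
Proof.
move=> [TP Ts] T3.
pose G : set A := [set w | exists u v, [/\ lcs_ideal A 2 u, lcs_ideal A 2 v & w =
  u * v]].
(* [T2] stands for [M_2 ^ 2] in the localization modulo [T] *)
pose T2 := sat_gen S (T `|` G); have [T2P T2s] := sat_gen_saturated S (T `|` G).
rewrite -/T2 in T2P T2s.
have TT2 : T `<=` T2 by move=> w Tw; apply: sub_sat_gen; left.
have GT2 u v : lcs_ideal A 2 u -> lcs_ideal A 2 v -> T2 (u * v).
  by move=> Mu Mv; apply: sub_sat_gen; right; exists u, v.
have T23 a b c : T2 (comm a (comm b c)) by apply: comm3_ideal => w /T3/TT2.
have der z u : lcs_ideal A 2 u -> T2 (comm z u).
  move=> /lcs_ideal_span; move: u; apply: (@span_min _ _ _ [set u | T2 (comm z u)]).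
    split=> [|k u v Tu Tv] /=; first by rewrite comm0r; apply: (ideal0 T2P).
    by rewrite commDr commZr; apply: (ideal_submodule T2P).2.
  move=> _ [a [l [l2 ->]]] /=; rewrite commMr; apply: (idealD T2P).
    by apply: GT2; [apply: comm_lcs_ideal2|apply: lcs_sub_ideal].
  by apply: (idealMl T2P); apply: TT2; apply: T3; apply: lcs_sub_ideal;
    apply: lcs_step.
have key y z : y \in Y -> T2 (comm z x) -> T2 (comm z y).
  move=> /unr[f [g [s [Sg Ss Msf fg]]]] Tzx.
  suff Tzf : T2 (comm z f).
    apply: (T2s g) => //; apply: (ideal_subl T2P _ Tzf).
    by apply: (fg T2) => // w /T3; apply: TT2.
  (* [s ^ 2 [z, f]] is [s [z, s f]] minus [s [z, s] f], and [s f] is in [M_2] *)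
  apply: (T2s s) => //; apply: (T2s s) => //.
  have : T2 (s * comm z (s * f)) by apply: (idealMl T2P); apply: der.
  rewrite commMr mulrDr => Tsum.
  have : T2 (s * (comm z s * f)).
    rewrite mulrA (mul_commE s) mulrDl -mulrA; apply: (idealD T2P).
      by apply: GT2 => //; apply: comm_lcs_ideal2.
    by apply: (idealMr T2P).
  by move=> /(idealB T2P Tsum); rewrite addrC addKr.
have T2c : forall a b, T2 (comm a b).
  apply: (commutative_mod gY T2P) => y z /= Yy Yz; apply: (key _ _ Yz).
  rewrite commC; apply: (idealN T2P); apply: (key _ _ Yy).
  by rewrite commxx; apply: (ideal0 T2P).
have MT2 : lcs_ideal A 2 `<=` T2 by apply: lcs_ideal2_min.
(* multiplying [M_2 <= T2] by [q] further factors *)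
have descend q : nil_mod (lcs_ideal A 2) T q.+2 -> nil_mod (lcs_ideal A 2) T q.+1.
  move=> nM [|u r]//= [rq] rM; rewrite big_cons.
  pose J := [set u | forall a r, size r = q -> (forall v, v \in r -> lcs_ideal A
    2 v) ->
    T (u * a * \prod_(v <- r) v)].
  suff /(_ u) : T2 `<=` J.
    rewrite -[u in u * \prod_(j <- r) j]mulr1; apply => //.
      by apply: MT2; apply: rM; rewrite mem_head.
    by move=> v vr; apply: rM; rewrite inE vr orbT.
  move=> {u r rq rM}; apply: sat_gen_min => [|w [Tw|[u [v [Mu Mv ->]]]] a r rq rM].
  - split=> [|s w Ss Jw a r rq rM]; last first.
      by apply: (Ts s) => //; rewrite !mulrA; apply: Jw.
    split=> [|u v Ju Jv|b u Ju] => [a r rq rM|a r rq rM|].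
    + by rewrite !mul0r; apply: (ideal0 TP).
    + by rewrite !mulrDl; apply: (idealD TP); [apply: Ju|apply: Jv].
    + split=> a r rq rM; first by rewrite -!mulrA; apply: (idealMl TP);
      rewrite mulrA; apply: Ju.
      by rewrite -(mulrA u); apply: Ju.
  - by apply/(idealMr TP)/(idealMr TP).
  - have := nM (u :: v * a :: r); rewrite !big_cons !mulrA; apply;
    first by rewrite /= rq.
    move=> t; rewrite !inE => /or3P[/eqP->|/eqP->|/rM] //.
    exact: (idealMr (lcs_idealP 2)).
have [n] := nil_lcs_ideal3 gY.
have: nil_mod (lcs_ideal A 2) T n -> nil_mod (lcs_ideal A 2) T 1.
  elim: n => [T1 [|y []]// _ _|[|n] IH //]; last by move/descend/IH.
  by rewrite big_seq1 -[y]mulr1; apply: (idealMl TP); have := T1 [::] erefl;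
    rewrite big_nil; apply.
move=> n1 nM a b; have {}n1 : nil_mod (lcs_ideal A 2) T 1.
  by apply: n1 => s sn sM; apply: T3; apply: nM.
have := n1 [:: comm a b] erefl.
rewrite big_seq1; apply=> z; rewrite inE => /eqP->; exact: comm_lcs_ideal2.
Qed.

(** For [k >= 3] the ideal [I] generated by [T] and [L_k] has square zero modulo
    [T]. By induction it contains all commutators, which makes it central modulo
    [T]; then [T] contains [M_3] and the previous lemma applies. *)
Lemma local_commutative k T : saturated S T -> lcs_ideal A k.+2 `<=` T ->
  forall a b, T (comm a b).
Proof.
elim: k T => [|[|k] IH] T sT TM.
- by move=> a b; apply: TM; apply: comm_lcs_ideal2.
- exact: local_commutative3.
apply: local_commutative3 => //; have [TP Ts] := sT.
pose I := sat_gen S (T `|` lcs A k.+3);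
  have sI : saturated S I by apply: sat_gen_saturated.
have [IP Is] := sI.
have Ic a b : I (comm a b).
  apply: IH => //; apply: lcs_ideal_min => // l lk.
  by apply: sub_sat_gen; right.
have Tc z l : lcs A k.+3 l -> T (comm z l).
  by move=> lk; apply: TM; apply: lcs_sub_ideal; apply: lcs_step.
have II0 u v : I u -> I v -> T (u * v).
  by apply: sat_gen_mul0 => // g h lg lh; apply: TM; apply: lcs_mul.
suff IZ : I `<=` [set u | I u /\ forall z, T (comm z u)].
  by apply: lcs_ideal3_min => // a b c; apply: (IZ _ (Ic b c)).2.
apply: sat_gen_min => [|u [Tu|lu]] /=.
- split=> [|s u Ss [/= Isu Tsu]]; last first.
    have Iu : I u by apply: (Is s).
    split=> // z; apply: (Ts s) => //; have := Tsu z;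
      rewrite commMr => /(idealB TP)/(_ (II0 _ _ (Ic z s) Iu)).
    by rewrite addrC addKr.
  split=> [|u v [Iu Tu] [Iv Tv]|a u [Iu Tu]] /=.
  + by split=> [|z]; [apply: (ideal0 IP)|rewrite comm0r; apply: (ideal0 TP)].
  + by split=> [|z]; [apply: (idealD IP)|rewrite commDr; apply: (idealD TP)].
  + split; (split=> [|z];
    [by [apply: (idealMl IP)|apply: (idealMr IP)]|rewrite commMr;
      apply: (idealD TP)]).
    * exact: II0.
    * exact: (idealMl TP).
    * exact: (idealMr TP).
    * exact: II0.
- by split=> [|z]; [apply: sub_sat_gen; left|apply: (ideal_comm TP)].
- by split=> [|z]; [apply: sub_sat_gen; right|apply: Tc].
Qed.

End Local.

End Saturation.

(** * Inverting elements modulo an ideal of the series *)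

Section Ore.
Variables (F : fieldType) (A : algType F).
Implicit Types (a b s t x y : A) (I S : set A).

Lemma lcs_iter_comm s k a : lcs A k.+1 (iter k (comm s) a).
Proof. by elim: k => [//|k IH]; rewrite iterS; apply: lcs_step. Qed.

(** Moving one factor [s] of [s ^+ j.+1 * a] past [a] costs a commutator with [s],
    and [j + 1] nested commutators vanish modulo [I]. *)
Lemma ore_condition I s j a : two_sided_ideal I -> I (iter j (comm s) a) ->
  exists b, I (s ^+ j * a - b * s).
Proof.
move=> IP; elim: j a => [|j IH] a; first by exists 0; rewrite mul1r mul0r subr0.
rewrite iterSr => /IH[b Ib]; exists (s ^+ j * a + b).
suff -> : s ^+ j.+1 * a - (s ^+ j * a + b) * s = s ^+ j * comm s a - b * s by [].
by rewrite /comm mulrBr mulrDl opprD addrA exprSr !mulrA.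
Qed.

Lemma left_annihilator_right I s j x : two_sided_ideal I ->
  I (s * x) -> I (iter j (comm s) x) -> I (x * s ^+ j).
Proof.
move=> IP; elim: j x => [|j IH] x Isx; first by rewrite mulr1.
rewrite iterSr => Ij; have -> : x * s ^+ j.+1 = s * x * s ^+ j - comm s x * s ^+ j.
  by rewrite /comm mulrBl subKr exprS mulrA.
apply: (idealB IP); first exact: (idealMr IP).
apply: IH => //; rewrite /comm mulrBr; apply: (idealB IP);
  first exact: (idealMl IP).
by rewrite mulrA; apply: (idealMr IP).
Qed.

Section Localization.
Variables (S : set A) (k : nat).
Hypothesis S1 : S 1.
Hypothesis SM : forall s t, S s -> S t -> S (s * t).

Let M := lcs_ideal A k.+1.
Let MP : two_sided_ideal M := lcs_idealP k.+1.

Definition torsion_mod : set A := [set x | exists2 s, S s & M (s * x)].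

Lemma SX s n : S s -> S (s ^+ n).
Proof. by move=> Ss; elim: n => [//|n IH]; rewrite exprS; apply: SM. Qed.

Lemma torsion_mod_saturated : saturated S torsion_mod.
Proof.
have ore s a : exists b, M (s ^+ k * a - b * s).
  by apply: ore_condition => //; apply: lcs_sub_ideal; apply: lcs_iter_comm.
split=> [|s x Ss [t St Mx]]; last by exists (t * s); [apply: SM|rewrite -mulrA].
split=> [|x y [s Ss Mx] [t St My]|a x [s Ss Mx]].
- by exists 1 => //; rewrite mulr0; apply: (ideal0 MP).
- have [b Mb] := ore t s; exists (t ^+ k * s); first by apply: SM => //; apply: SX.
  rewrite mulrDr; apply: (idealD MP); first by rewrite -mulrA; apply: (idealMl MP).
  rewrite -[_ * s](subrK (b * t)) mulrDl -(mulrA b); apply: (idealD MP).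
    exact: (idealMr MP).
  exact: (idealMl MP).
- split; last by exists s => //; rewrite mulrA; apply: (idealMr MP).
  have [b Mb] := ore s a; exists (s ^+ k); first exact: SX.
  rewrite mulrA -[_ * a](subrK (b * s)) mulrDl -(mulrA b); apply: (idealD MP).
    exact: (idealMr MP).
  exact: (idealMl MP).
Qed.

(** By the Ore condition a power of an annihilator of one generator kills all
    left multiples of it, so annihilators of the finitely many generators can be
    multiplied; a further power acts from the right. *)
Lemma torsion_uniform (cs : seq A) : (forall c, c \in cs -> torsion_mod c) ->
  exists2 s, S s & forall x, ideal_gen [set` cs] x -> M (s * x) /\ M (x * s).
Proof.
have ad s a : M (iter k (comm s) a) by apply: lcs_sub_ideal; apply: lcs_iter_comm.
move=> tcs; suff [s Ss sM] :
  exists2 s, S s & forall x, ideal_gen [set` cs] x -> M (s * x).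
  exists (s * s ^+ k); first by apply: SM => //; apply: SX.
  move=> x Jx; split; first by rewrite -mulrA; apply: sM;
    apply: (idealMl (ideal_gen_two_sided [set` cs])).
  rewrite mulrA; apply: (left_annihilator_right MP) => //.
  by rewrite mulrA; apply: (idealMr MP); apply: sM.
have [s Ss sM] : exists2 s, S s & forall a c, c \in cs -> M (s * (a * c)).
  elim: cs tcs => [|c cs IH] tcs; first by exists 1.
  have [|s Ss sM] := IH; first by move=> d dcs; apply: tcs; rewrite inE dcs orbT.
  have [t St Mtc] := tcs c (mem_head _ _).
  exists (s * t ^+ k); first by apply: SM => //; apply: SX.
  move=> a d; rewrite inE => /predU1P[->|dcs];
    last by rewrite -mulrA (mulrA _ a); apply: sM.
  have [b Mb] := @ore_condition M t k a MP (ad t a).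
  rewrite -mulrA; apply: (idealMl MP);
    rewrite mulrA -[_ * a](subrK (b * t)) mulrDl -(mulrA b).
  by apply: (idealD MP); [apply: (idealMr MP)|apply: (idealMl MP)].
exists s => // x Jx; rewrite -[x]mul1r; move: (1 : A); move: x Jx.
apply: (@ideal_gen_min _ _ _ [set x | forall a, M (s * (a * x))]) =>
  [|c ccs a] /=; last exact: sM.
split=> [a|x y hx hy a|b x hx] /=; first by rewrite !mulr0; apply: (ideal0 MP).
  by rewrite !mulrDr; apply: (idealD MP); [apply: hx|apply: hy].
by split=> a; rewrite !mulrA; [rewrite -!mulrA (mulrA a);
  apply: hx|apply: (idealMr MP); rewrite -mulrA; apply: hx].
Qed.

End Localization.

End Ore.

(** * Primes of the abelianization *)

Section Reduced.
Variables (X : comPzRingType) (p : Spec X).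

Lemma nonreduced_local_ring (q : X) n : q ^+ n = 0 ->
  (forall t, ~ spec_set p t -> t * q <> 0) -> ~ reduced (local_ring p).
Proof.
move=> qn0 tq red.
pose i (x : X) : local_ring p := (\pi_(local_ring p) (x, denominator1 p))%qT.
have iX m : i q ^+ m = i (q ^+ m).
  elim: m => [//|m IH]; rewrite !exprS IH.
  apply: (etrans (local_mulE (q, denominator1 p) (q ^+ m, denominator1 p))).
  by apply: local_eq_frac; rewrite /= !mulr1.
have /red/local_eqP[t /=] : i q ^+ n = 0 by rewrite iX qn0.
by rewrite !mulr1 mulr0; apply: tq; apply: denominatorP.
Qed.

End Reduced.

Section CentralPrimes.
Variables (F : fieldType) (A : algType F).
Implicit Types (a b s t u x y : A) (I P Q U : set A).

(** The primes of the abelianization, seen as completely prime ideals of [A]. *)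
Record central_prime P : Prop := CentralPrime {
  cprime_ideal : two_sided_ideal P;
  cprime_proper : ~ P 1;
  cprime_mul : forall a b, P (a * b) -> P a \/ P b;
  cprime_comm : lcs_ideal A 2 `<=` P }.

Lemma cprime_exp P x n : central_prime P -> P (x ^+ n) -> P x.
Proof.
move=> PP; elim: n => [/(cprime_proper PP)//|n IH].
by rewrite exprS => /(cprime_mul PP)[//|/IH].
Qed.

(** An ideal maximal among those that avoid a multiplicative set is prime. Only
    because it contains the commutators is [Q + A x] a two-sided ideal. *)
Lemma central_prime_exists I U : two_sided_ideal I -> lcs_ideal A 2 `<=` I ->
    U 1 -> (forall u v, U u -> U v -> U (u * v)) -> (forall u, U u -> ~ I u) ->
  exists P, [/\ central_prime P, I `<=` P & forall u, U u -> ~ P u].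
Proof.
move=> II I2 U1 UM UI.
pose good Q := two_sided_ideal Q /\ forall u, U u -> ~ Q u.
have [C CF CC|B [[QP QU] Bmax]] := @Zorn_bigcup A [set B | good (I `|` B)].
  rewrite /good /=; have goodC B : C B -> good (I `|` B) by apply: CF.
  have joint x y : (I `|` \bigcup_(B in C) B) x -> (I `|` \bigcup_(B in C) B) y ->
      exists B, [/\ good (I `|` B), B `<=` \bigcup_(B in C) B, (I `|` B) x & (I
        `|` B) y].
    move=> [Ix|[B CB Bx]] [Iy|[B' CB' By]].
    - by exists set0; rewrite setU0; split.
    - by exists B'; split; [apply: goodC|apply: bigcup_sup|left|right].
    - by exists B; split; [apply: goodC|apply: bigcup_sup|right|left].
    - have [BB'|B'B] := CC _ _ CB CB'.
        by exists B'; split; [apply: goodC|apply: bigcup_sup|right;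
          apply: BB'|right].
      by exists B; split; [apply: goodC|apply: bigcup_sup|right|right; apply: B'B].
  split; last by move=> u Uu [/(UI u Uu)//|[B CB Bu]];
    apply: (goodC B CB).2 (Uu) _; right.
  split=> [|x y hx hy|a x hx]; first by left; apply: (ideal0 II).
    have [B [[BP _] BC Bx By]] := joint x y hx hy.
    by apply: (setUS BC); apply: (idealD BP).
  have [B [[BP _] BC Bx _]] := joint x x hx hx.
  by split; apply: (setUS BC); [apply: (idealMl BP)|apply: (idealMr BP)].
set Q := I `|` B in QP QU.
have IQ : I `<=` Q by move=> x; left.
have Q2 : lcs_ideal A 2 `<=` Q by move=> x /I2/IQ.
(* maximality of [Q] makes the larger ideal [Q + A x] meet [U] *)
have meet x : ~ Q x -> exists u r, U u /\ Q (u - r * x).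
  move=> Qx; apply: contrapT => nU.
  pose Q' : set A := [set y | exists r, Q (y - r * x)].
  have QQ' : Q `<=` Q' by move=> y Qy; exists 0; rewrite mul0r subr0.
  have Q'x : Q' x by exists 1; rewrite mul1r subrr; apply: (ideal0 QP).
  apply: (Bmax Q').
    split; first by move=> y By; apply: QQ'; right.
    by move=> /(_ x Q'x) Bx; apply: Qx; right.
  rewrite /= (_ : I `|` Q' = Q'); last by apply: setUidr => y /IQ/QQ'.
  split; last by move=> u Uu [r Qr]; apply: nU; exists u, r.
  split=> [|y z [r Qr] [r' Qr']|a y [r Qr]]; first by apply: QQ';
    apply: (ideal0 QP).
    by exists (r + r'); rewrite mulrDl opprD addrACA; apply: (idealD QP).
  split; first by exists (a * r); rewrite -mulrA -mulrBr; apply: (idealMl QP).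
  exists (r * a); have -> : y * a - r * a * x = (y - r * x) * a + r * comm x a.
    by rewrite /comm mulrBl mulrBr !mulrA addrA subrK.
  by apply: (idealD QP); [apply: (idealMr QP)|apply: (idealMl QP); apply: Q2;
    apply: comm_lcs_ideal2].
exists Q; split=> //; split=> // [|a b Qab]; first exact: QU.
apply: contrapT => /not_orP[/meet[u [r [Uu Qu]]] /meet[v [r' [Uv Qv]]]].
apply: (QU _ (UM u v Uu Uv)).
apply: (ideal_sub QP (y := r * a * v)); first by rewrite -mulrBl;
  apply: (idealMr QP).
apply: (ideal_sub QP (y := r * a * (r' * b))); first by rewrite -mulrBr;
  apply: (idealMl QP).
have -> : r * a * (r' * b) = r * r' * (a * b) + r * comm a r' * b.
  by rewrite /comm mulrBr mulrBl !mulrA addrC subrK.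
apply: (idealD QP); first exact: (idealMl QP).
by apply: (idealMr QP); apply: (idealMl QP); apply: Q2; apply: comm_lcs_ideal2.
Qed.

Local Notation X := (abelianization A).

Definition ab_pr (x : A) : X := (\pi_(abelianization A) x)%qT.

Lemma ab_prM x y : ab_pr (x * y) = ab_pr x * ab_pr y.
Proof. by rewrite /ab_pr -ab_mulE. Qed.

Lemma ab_prD x y : ab_pr (x + y) = ab_pr x + ab_pr y.
Proof. exact: (@quot_modD _ _ (lcs_ideal_subspace A 2)). Qed.

Lemma ab_pr_eq0 x : ab_pr x = 0 <-> lcs_ideal A 2 x.
Proof. exact: (@quot_pi_eq0 _ _ (lcs_ideal_subspace A 2)). Qed.

Lemma ab_prX x n : ab_pr (x ^+ n) = ab_pr x ^+ n.
Proof. by elim: n => [//|n IH]; rewrite !exprS ab_prM IH. Qed.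

Lemma ab_prP (q : X) : exists x, q = ab_pr x.
Proof. by exists (repr q); rewrite /ab_pr reprK. Qed.

Lemma spec_of_central_prime P : central_prime P ->
  exists p : Spec X, forall x, spec_set p (ab_pr x) <-> P x.
Proof.
move=> PP; have IP := cprime_ideal PP.
pose Q : set X := [set q | exists2 x, P x & q = ab_pr x].
have QP x : Q (ab_pr x) <-> P x.
  split=> [[y Py /ab_eqP xy]|Px]; last by exists x.
  by apply: (ideal_sub IP) Py; apply: (cprime_comm PP).
suff Qprime : prime_ideal Q by exists (SpecPoint Qprime).
split.
- split=> [|q r|q r].
  + exists 0; first exact: (ideal0 IP).
    by apply/esym/ab_pr_eq0; apply: (ideal0 (lcs_idealP 2)).
  + move=> [x Px ->] [y Py ->]; exists (x + y); last by rewrite ab_prD.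
    exact: (idealD IP).
  + move=> [x Px ->]; have [a ->] := ab_prP q; split; rewrite -ab_prM; apply/QP.
      exact: (idealMl IP).
    exact: (idealMr IP).
- by move=> /(QP 1)/(cprime_proper PP).
- move=> q r; have [x ->] := ab_prP q; have [y ->] := ab_prP r.
  by rewrite -ab_prM !QP; apply: (cprime_mul PP).
Qed.

Lemma krull_dim1_chain P0 P1 P2 : krull_dim_le X 1 ->
  central_prime P0 -> central_prime P1 -> central_prime P2 ->
  P0 `<=` P1 -> P1 `<=` P2 -> P1 `<=` P0 \/ P2 `<=` P1.
Proof.
move=> dim C0 C1 C2 P01 P12; apply: contrapT => /not_orP[n10 n21].
have [p0 e0] := spec_of_central_prime C0.
have [p1 e1] := spec_of_central_prime C1.
have [p2 e2] := spec_of_central_prime C2.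
suff: (2 <= 1)%N by [].
apply: (dim 2%N (fun i => match i with 0 => p0 | 1 => p1 | _ => p2 end)).
case=> [|[|//]] _; split.
- by move=> q; have [x ->] := ab_prP q; rewrite e0 e1; apply: P01.
- by move=> h; apply: n10 => x /e1/h/e0.
- by move=> q; have [x ->] := ab_prP q; rewrite e1 e2; apply: P12.
- by move=> h; apply: n21 => x /e2/h/e1.
Qed.

End CentralPrimes.

(** * Homogeneous ideals *)

Section Grading.
Variables (F : fieldType) (A : algType F) (gr : nat -> set A).
Hypothesis hgr : is_grading gr.
Implicit Types (x y z a b : A) (I P : set A).

Lemma gr_submodule n : submodule (gr n).
Proof. exact/submoduleP/(gr_submod hgr). Qed.

Lemma grX n x k : gr n x -> gr (n * k) (x ^+ k).
Proof.
move=> gx; elim: k => [|k IH]; first by rewrite muln0; apply: gr_one hgr.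
by rewrite mulnS exprS; apply: gr_mul hgr _ _ _ _ gx IH.
Qed.

Definition graded_poly (p : {poly A}) : Prop := forall i, gr i p`_i.

Lemma graded_polyM p q : graded_poly p -> graded_poly q -> graded_poly (p * q).
Proof.
move=> gp gq i; rewrite coefM; apply: (submod_sum (gr_submodule i)) => j _.
have -> : gr i = gr (j + (i - j)) by congr gr; rewrite subnKC // -ltnS.
exact: gr_mul hgr _ _ _ _ (gp j) (gq _).
Qed.

Lemma homog_proof x : exists p, graded_poly p /\ p.[1] = x.
Proof.
have [n [c [gc ->]]] := gr_sum hgr x.
exists (\poly_(i < n) c i); split=> [i|].
  rewrite coef_poly; case: ifP => // _; exact: (submod0 (gr_submodule i)).
by rewrite horner_poly; apply: eq_bigr => i _; rewrite expr1n mulr1.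
Qed.

(** The homogeneous components of an element are the coefficients of a
    polynomial, so that this map is a morphism of rings. *)
Definition homog x : {poly A} := sval (cid (homog_proof x)).

Lemma homog_graded x : graded_poly (homog x).
Proof. by rewrite /homog; case: cid => p []. Qed.

Lemma homog_horner x : (homog x).[1] = x.
Proof. by rewrite /homog; case: cid => p []. Qed.

Lemma homog_unique p : graded_poly p -> homog p.[1] = p.
Proof.
move=> gp; apply/eqP; rewrite -subr_eq0; set q := _ - p.
have gq i : gr i q`_i.
  by rewrite coefB; apply: (submodB (gr_submodule i)) => //; apply: homog_graded.
have q1 : \sum_(i < size q) q`_i = 0.
  transitivity q.[1]; last by rewrite hornerD hornerN homog_horner subrr.
  by rewrite horner_coef; apply: eq_bigr => i _; rewrite expr1n mulr1.
apply/eqP/polyP => i; rewrite coef0;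
  have [/(gr_direct hgr gq q1)//|] := ltnP i (size q).
exact: nth_default.
Qed.

Lemma homogD x y : homog (x + y) = homog x + homog y.
Proof.
rewrite -{1}(homog_horner x) -{1}(homog_horner y) -hornerD homog_unique // => i.
by rewrite coefD; apply: (submodD (gr_submodule i)); apply: homog_graded.
Qed.

Lemma homogM x y : homog (x * y) = homog x * homog y.
Proof.
rewrite -{1}(homog_horner x) -{1}(homog_horner y) -hornerM_comm; last first.
  by rewrite /comm_poly mulr1 mul1r.
by rewrite homog_unique //; apply: graded_polyM; apply: homog_graded.
Qed.

Lemma homog_gr n x : gr n x -> homog x = x%:P * 'X^n.
Proof.
move=> gx; have -> : homog x = homog (x%:P * 'X^n).[1].
  by rewrite hornerCM hornerXn expr1n mulr1.
apply: homog_unique => i; rewrite coefCM coefXn; case: eqP => [->|_].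
  by rewrite mulr1.
by rewrite mulr0; apply: (submod0 (gr_submodule i)).
Qed.

Lemma homog_grE n x i : gr n x -> (homog x)`_i = if i == n then x else 0.
Proof. by move=> /homog_gr->; rewrite coefCM coefXn; case: eqP;
  rewrite ?mulr1 ?mulr0. Qed.

Lemma homog0 : homog 0 = 0.
Proof. by rewrite (homog_gr (submod0 (gr_submodule 0))) mul0r. Qed.

Lemma homogZ (k : F) x i : (homog (k *: x))`_i = k *: (homog x)`_i.
Proof.
have g : gr 0 (k *: 1) by apply: (submodZ (gr_submodule 0)); apply: gr_one hgr.
by rewrite -[x in LHS]mul1r scalerAl homogM (homog_gr g) mulr1 coefCM -scalerAl
  mul1r.
Qed.

Lemma homogMgr n x y i : gr n y -> (homog (x * y))`_(i + n) = (homog x)`_i * y.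
Proof.
move=> gy; rewrite homogM (homog_gr gy) mulrA coefMXn.
by rewrite ltnNge leq_addl /= addnK coefMC.
Qed.

Lemma homog_grM n x y i : gr n x -> (homog (x * y))`_(n + i) = x * (homog y)`_i.
Proof.
move=> gx; rewrite homogM (homog_gr gx) -mulrA coefCM coefXnM.
by rewrite ltnNge leq_addr /= addKn.
Qed.

Lemma homog_sum x : x = \sum_(i < size (homog x)) (homog x)`_i.
Proof.
rewrite -{1}(homog_horner x) horner_coef.
by apply: eq_bigr => i _; rewrite expr1n mulr1.
Qed.

(** For an ideal [I] this is the largest homogeneous ideal contained in it. *)
Definition star I : set A := [set x | forall i, I (homog x)`_i].

Definition homogeneous I : Prop := I `<=` star I.

Lemma star_sub I : submodule I -> star I `<=` I.
Proof. by move=> IP x sx; rewrite (homog_sum x); apply: (submod_sum IP). Qed.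

Lemma star_submodule I : submodule I -> submodule (star I).
Proof.
move=> IP; split=> [i|k x y Ix Iy i]; first by rewrite homog0 coef0; apply: IP.1.
by rewrite homogD coefD homogZ; apply: IP.2.
Qed.

Lemma star_homogeneous I : submodule I -> homogeneous (star I).
Proof.
move=> IP x sx i j; rewrite (homog_grE _ (homog_graded x i)).
by case: eqP => // _; apply: IP.1.
Qed.

Lemma star_ideal I : two_sided_ideal I -> two_sided_ideal (star I).
Proof.
move=> IP; have sP := star_submodule (ideal_submodule IP).
split=> [|x y|a x sx]; [exact: sP.1|exact: submodD|].
by split=> i; rewrite homogM coefM; apply: (submod_sum (ideal_submodule IP)) => j _;
   [apply: (idealMl IP)|apply: (idealMr IP)].
Qed.

Lemma ideal_gen_homogeneous G :
  (forall x, G x -> star (ideal_gen G) x) -> homogeneous (ideal_gen G).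
Proof.
by move=> hG; apply: ideal_gen_min => //; apply/star_ideal/ideal_gen_two_sided.
Qed.

Lemma lcs_homogeneous k : homogeneous (lcs A k).
Proof.
elim: k => [//|[//|k] IH]; apply: lcs_min => [|a b lb i].
  exact/star_submodule/lcs_submodule.
have -> : (homog (comm a b))`_i =
    \sum_(j < i.+1) comm (homog a)`_j (homog b)`_(i - j).
  have hN y : homog (- y) = - homog y.
    by apply/eqP; rewrite -addr_eq0 -homogD addNr homog0.
  by rewrite homogD hN !homogM coefB coefM coefMr -sumrB.
by apply: (submod_sum (lcs_submodule _)) => j _; apply: lcs_step; apply: IH.
Qed.

Lemma lcs_ideal_homogeneous k : homogeneous (lcs_ideal A k).
Proof.
apply: lcs_ideal_min; first exact/star_ideal/lcs_idealP.
by move=> x /lcs_homogeneous sx i; apply: lcs_sub_ideal; apply: sx.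
Qed.

(** If [a_i] and [b_j] are the first components outside [P], then [a_i * b_j] is
    modulo [P] the component of degree [i + j] of [a * b]. *)
Lemma star_central_prime P : central_prime P -> central_prime (star P).
Proof.
move=> PP; have IP := cprime_ideal PP.
have first_out x : ~ star P x ->
    exists i, ~ P (homog x)`_i /\ forall j, (j < i)%N -> P (homog x)`_j.
  move=> /existsNP[i0 Pi0].
  have ex : exists i, `[< ~ P (homog x)`_i >] by exists i0; apply/asboolP.
  case: (ex_minnP ex) => i /asboolP Pi mini; exists i; split=> // j ji.
  by apply: contrapT => /asboolP/mini; rewrite leqNgt ji.
split; first exact: star_ideal.
- by move=> /(star_sub (ideal_submodule IP)); apply: cprime_proper.
- move=> a b sab; apply: contrapT =>
  /not_orP[/first_out[i [Pi ai]] /first_out[j [Pj bj]]].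
  suff /(cprime_mul PP)[] : P ((homog a)`_i * (homog b)`_j) by [].
  have ij : (i < (i + j).+1)%N by rewrite ltnS leq_addr.
  have := sab (i + j)%N; rewrite homogM coefM (bigD1 (Ordinal ij)) //= addKn.
  set r := \sum_(_ < _ | _) _; have Pr : P r.
    apply: (submod_sum (ideal_submodule IP)) => l /eqP li.
    have [lti|] := ltnP l i; first by apply: (idealMr IP); apply: ai.
    rewrite leq_eqVlt => /predU1P[il|il]; first by case: li; apply: val_inj.
    apply: (idealMl IP); apply: bj; have := ltn_ord l; lia.
  by move=> /(idealB IP)/(_ Pr); rewrite addrK.
- by move=> x /lcs_ideal_homogeneous Mx i; apply: (cprime_comm PP).
Qed.

Section Irrelevant.
Hypothesis hgen : generates (gr 1).

Definition irrelevant : set A := [set x | (homog x)`_0 = 0].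

Lemma homog0_scalar x : exists k : F, (homog x)`_0 = k *: 1.
Proof.
move: x; apply: (generates_ind (C :=
  [set x | exists k : F, (homog x)`_0 = k *: 1]) hgen) => /=.
- split=> [|k x y [c cx] [d dy]]; first by exists 0; rewrite homog0 coef0 scale0r.
  by exists (k * c + d); rewrite homogD coefD homogZ cx dy scalerA scalerDl.
- by exists 1; rewrite (homog_grE _ (gr_one hgr)) scale1r.
- move=> x y [c cx] [d dy]; exists (c * d).
  by rewrite homogM coef0M cx dy -scalerAl mul1r scalerA.
- by move=> x gx; exists 0; rewrite (homog_grE _ gx) scale0r.
Qed.

Lemma irrelevant_prime : central_prime irrelevant.
Proof.
have IP : two_sided_ideal irrelevant.
  split=> [|x y|a x]; rewrite /irrelevant /=; first by rewrite homog0 coef0.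
    by move=> hx hy; rewrite homogD coefD hx hy addr0.
  by move=> hx; rewrite !homogM !coef0M hx mulr0 mul0r.
split=> //.
- by rewrite /irrelevant /= (homog_grE _ (gr_one hgr)) => /eqP; rewrite oner_eq0.
- move=> a b; rewrite /irrelevant /= homogM coef0M.
  have [k ->] := homog0_scalar a; have [l ->] := homog0_scalar b.
  rewrite -scalerAl mul1r scalerA => /eqP;
    rewrite scaler_eq0 oner_eq0 orbF mulf_eq0.
  by case/orP => /eqP->; rewrite scale0r; [left|right].
- apply: lcs_ideal2_min => // a b; rewrite /irrelevant /=.
  rewrite /comm homogD coefD -[- (b * a)]scaleN1r homogZ !homogM !coef0M.
  have [k ->] := homog0_scalar a; have [l ->] := homog0_scalar b.
  by rewrite -!scalerAl !mul1r scalerA mulrC -scalerA scaleN1r subrr.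
Qed.

Lemma homogeneous_sub_irrelevant P :
  central_prime P -> homogeneous P -> P `<=` irrelevant.
Proof.
move=> PP hP x /hP/(_ 0%N); rewrite /irrelevant /=; have [k ->] := homog0_scalar x.
have [->|k0] := eqVneq k 0; first by rewrite scale0r.
move=> /(idealZ (cprime_ideal PP) k^-1); rewrite scalerA mulVf // scale1r.
by move=> /(cprime_proper PP).
Qed.

Lemma gr1_irrelevant x : gr 1 x -> irrelevant x.
Proof. by move=> gx; rewrite /irrelevant /= (homog_grE _ gx). Qed.

End Irrelevant.

End Grading.

(** * Words in the generators *)

Section Words.
Variables (F : fieldType) (A : algType F).
Implicit Types (x y z a b : A) (I P : set A) (Y : seq A).

Fixpoint words Y n : seq A :=
  if n is n'.+1 then [seq y * w | y <- Y, w <- words Y n'] else [:: 1].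

Lemma wordsM Y m n v w : v \in words Y m -> w \in words Y n ->
  v * w \in words Y (m + n).
Proof.
elim: m v => [|m IH] v /=; first by rewrite inE => /eqP->; rewrite mul1r.
move=> /allpairsP[[y v'] [/= yY v'Y ->]] wY; rewrite -mulrA.
by apply: allpairs_f => //; apply: IH.
Qed.

Lemma words_splitP Y m n w : w \in words Y (m + n) ->
  exists u v, [/\ u \in words Y m, v \in words Y n & w = u * v].
Proof.
elim: m w => [|m IH] w /=; first by move=> wY; exists 1, w; rewrite inE mul1r.
move=> /allpairsP[[y w'] [/= yY /IH[u [v [uY vY ->]]] ->]].
by exists (y * u), v; rewrite mulrA; split=> //; apply: allpairs_f.
Qed.

Lemma words_prodP Y n w : w \in words Y n ->
  exists s : seq A, [/\ size s = n, {subset s <= Y} & w = \prod_(y <- s) y].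
Proof.
elim: n w => [|n IH] w /=; first by rewrite inE => /eqP->; exists [::];
  rewrite big_nil.
move=> /allpairsP[[y w'] [/= yY /IH[s [<- sY ->]] ->]].
exists (y :: s); rewrite big_cons; split=> // z; rewrite inE.
by case/predU1P => [->|/sY].
Qed.

Lemma words_span Y x : generates [set` Y] ->
  span [set w | exists n, w \in words Y n] x.
Proof.
move=> gY; set W := [set w | _]; have WP := span_submodule W; move: x.
apply: (generates_ind gY WP) => [|x y|y yY]; first by apply: sub_span;
  exists 0%N; rewrite inE.
  move=> Wx Wy; move: x Wx; apply: (@span_min _ _ _ [set x | span W (x * y)]).
    split=> [|k u v] /=; first by rewrite mul0r; apply: WP.1.
    by rewrite mulrDl -scalerAl; apply: WP.2.
  move=> v [m vm] /=; move: y Wy; apply: (@span_min _ _ _ [set y | span W (v * y)]).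
    split=> [|k u u'] /=; first by rewrite mulr0; apply: WP.1.
    by rewrite mulrDr -scalerAr; apply: WP.2.
  by move=> w [n wn]; apply: sub_span; exists (m + n)%N; apply: wordsM.
by apply: sub_span; exists 1%N; apply/allpairsP; exists (y, 1); rewrite inE mulr1.
Qed.

(** Up to commutators a word is a product of powers of letters; if it is long,
    one of the exponents is large. *)
Lemma long_prod_in_ideal Y I : two_sided_ideal I -> lcs_ideal A 2 `<=` I ->
    (forall y, y \in Y -> exists n, I (y ^+ n)) ->
  exists N, forall s : seq A, {subset s <= Y} -> (N <= size s)%N ->
    I (\prod_(y <- s) y).
Proof.
move=> IP I2; elim: Y => [|y Y IH] hY.
  by exists 1%N => -[//|z s] sY; have := sY z; rewrite inE eqxx => /(_ isT).
have [|N hN] := IH; first by move=> z zY; apply: hY; rewrite inE zY orbT.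
have [n yn] := hY y (mem_head _ _).
exists (n + N)%N => s sY Ns.
have collect (t : seq A) : I (\prod_(z <- t) z -
    y ^+ (count_mem y t) * \prod_(z <- [seq z <- t | z != y]) z).
  elim: t => [|z t It]; first by rewrite !big_nil mulr1 subrr; apply: (ideal0 IP).
  rewrite big_cons /=; case: (eqVneq z y) => [->|zy] /=.
    by rewrite add1n exprS -mulrA -mulrBr; apply: (idealMl IP).
  rewrite big_cons add0n mulrA (mul_commE _ z) mulrDl opprD addrA -mulrA -mulrBr.
  apply: (idealB IP); first exact: (idealMl IP).
  by apply: (idealMr IP); apply: I2; apply: comm_lcs_ideal2.
apply: (ideal_sub IP (collect s)); have [nc|cn] := leqP n (count_mem y s).
  by rewrite -(subnKC nc) exprD -mulrA; apply: (idealMr IP).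
apply: (idealMl IP); apply: hN => [z|].
  by rewrite mem_filter => /andP[zy /sY]; rewrite inE (negPf zy).
have -> : size [seq z <- s | z != y] = (size s - count_mem y s)%N.
  by rewrite size_filter -(count_predC (pred1 y) s) addKn.
by lia.
Qed.

Lemma long_words_in_ideal Y I : two_sided_ideal I -> lcs_ideal A 2 `<=` I ->
    (forall y, y \in Y -> exists n, I (y ^+ n)) ->
  exists N, forall n w, (N <= n)%N -> w \in words Y n -> I w.
Proof.
move=> IP I2 /(long_prod_in_ideal IP I2)[N hN]; exists N => n w Nn.
by move=> /words_prodP[s [sn sY ->]]; apply: hN => //; rewrite sn.
Qed.

Section GradedWords.
Variable gr : nat -> set A.
Hypothesis hgr : is_grading gr.
Variable Y : seq A.
Hypothesis gY : generates [set` Y].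
Hypothesis Y1 : forall y, y \in Y -> gr 1 y.

Lemma words_gr n w : w \in words Y n -> gr n w.
Proof.
elim: n w => [|n IH] w /=; first by rewrite inE => /eqP->; apply: gr_one hgr.
move=> /allpairsP[[y w'] [/= /Y1 y1 /IH w'n ->]].
exact: gr_mul hgr _ _ _ _ y1 w'n.
Qed.

Lemma gr_words_span n x : gr n x -> span [set` words Y n] x.
Proof.
move=> gx; have -> : x = (homog hgr x)`_n by rewrite (homog_grE hgr n gx) eqxx.
have WP := span_submodule [set` words Y n].
have := words_span x gY; move: {gx} x.
apply: (@span_min _ _ _ [set x | span [set` words Y n] (homog hgr x)`_n]).
  split=> [|k u v] /=; first by rewrite homog0 coef0; apply: WP.1.
  by rewrite homogD coefD homogZ; apply: WP.2.
move=> w [m wm] /=; rewrite (homog_grE hgr n (words_gr wm)).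
by case: eqP => [->|_]; [apply: sub_span|apply: WP.1].
Qed.

End GradedWords.

(** Each of the finitely many generators is a polynomial in finitely many
    elements of [G]. *)
Lemma finite_generators (G : set A) : finitely_generated A -> generates G ->
  exists Y : seq A, (forall y, y \in Y -> G y) /\ generates [set` Y].
Proof.
move=> [S [/finite_seqP[s ->] gS]] gG.
pose alg (Y : seq A) x := forall C : set A, submodule C -> C 1 ->
  (forall x y, C x -> C y -> C (x * y)) -> [set` Y] `<=` C -> C x.
have alg_sub (Y Y' : seq A) x : {subset Y <= Y'} -> alg Y x -> alg Y' x.
  by move=> YY' Yx C CP C1 CM CY'; apply: Yx => // z /YY'/CY'.
have ex x : exists Y : seq A, (forall y, y \in Y -> G y) /\ alg Y x.
  move: x; apply: (@generates_ind _ _ G [set x | exists Y :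
    seq A, _ /\ alg Y x]) => //=.
  - split=> [|k x y [Y [YG Yx]] [Z [ZG Zy]]] /=.
      by exists [::]; split=> // C [].
    exists (Y ++ Z); split=> [z|C CP C1 CM CYZ].
      by rewrite mem_cat => /orP[/YG|/ZG].
    apply: CP.2; [apply: Yx|apply: Zy] => // z zY; apply: CYZ => /=;
      by rewrite mem_cat zY ?orbT.
  - by exists [::]; split.
  - move=> x y [Y [YG Yx]] [Z [ZG Zy]]; exists (Y ++ Z); split=> [z|C CP C1 CM CYZ].
      by rewrite mem_cat => /orP[/YG|/ZG].
    apply: (CM x y); [apply: Yx|apply: Zy] => // z zY; apply: CYZ => /=;
      by rewrite mem_cat zY ?orbT.
  - move=> x Gx; exists [:: x]; split=> [y|C _ _ _ Cx];
    first by rewrite inE => /eqP->.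
    by apply: Cx; rewrite /= inE.
have [Y [YG sY]] : exists Y : seq A, (forall y, y \in Y -> G y) /\
    forall x, x \in s -> alg Y x.
  elim: (s) => [|x r [Y [YG rY]]]; first by exists [::].
  have [Z [ZG Zx]] := ex x; exists (Y ++ Z); split=> [z|z].
    by rewrite mem_cat => /orP[/YG|/ZG].
  rewrite inE => /predU1P[->|/rY Yz]; [apply: alg_sub Zx|apply: alg_sub Yz] => t tY;
    by rewrite mem_cat tY ?orbT.
exists Y; split=> //; rewrite /generates eqEsubset;
  split=> // x _ C [[C1 Cl CM] YC].
have: setT x by []; rewrite -gS => /(_ C); apply; split=> // z zs.
apply: (sY z zs) => //.
- apply/submoduleP; split=> //; rewrite -(subrr 1) -scaleN1r addrC.
  exact: Cl.
- exact/set_mem.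
- by move=> u v /mem_set Cu /mem_set Cv; apply/set_mem/CM.
Qed.

End Words.

(** * Finite-dimensional subquotients *)

Section FiniteDimension.
Variables (F : fieldType) (V : lmodType F).

Definition spanning n (v : 'I_n -> V) : Prop :=
  forall x, exists r : 'rV[F]_n, x = \sum_i r 0 i *: v i.

Lemma spanning_drop n (v : 'I_n.+1 -> V) (r : 'rV[F]_n.+1) i :
  spanning v -> r 0 i != 0 -> \sum_j r 0 j *: v j = 0 ->
  spanning (fun j => v (lift i j)).
Proof.
move=> sv ri r0 x; have [s ->] := sv x.
exists (\row_j (s 0 (lift i j) - s 0 i / r 0 i * r 0 (lift i j))).
have -> : \sum_j s 0 j *: v j =
    \sum_j (s 0 j *: v j - (s 0 i / r 0 i) *: (r 0 j *: v j)).
  by rewrite sumrB -scaler_sumr r0 scaler0 subr0.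
rewrite (bigD1_ord i) //= scalerA divfK // subrr add0r.
by apply: eq_bigr => j _; rewrite mxE scalerBl scalerA.
Qed.

(** A spanning family of minimal length is a basis. *)
Lemma spanning_fin_dim n (v : 'I_n -> V) : spanning v -> fin_dim V.
Proof.
move=> sv; have ex : exists n, `[< exists v : 'I_n -> V, spanning v >].
  by exists n; apply/asboolP; exists v.
case: (ex_minnP ex) => {v sv ex} m /asboolP[v sv] mmin; exists m; constructor.
pose phi (r : 'rV[F]_m) := \sum_i r 0 i *: v i.
have phi_lin k r s : phi (k *: r + s) = k *: phi r + phi s.
  rewrite /phi scaler_sumr -big_split; apply: eq_bigr => i _.
  by rewrite !mxE scalerDl scalerA.
have phi0 r : phi r = 0 -> r = 0.
  move=> r0; apply/rowP => i; rewrite mxE; apply/eqP; apply: contraT => ri.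
  case: m v sv mmin @phi phi_lin r r0 i ri => [|m] v sv mmin phi _ r r0 i ri;
    first by case: i ri.
  suff /mmin : `[< exists v : 'I_m -> V, spanning v >] by rewrite ltnn.
  by apply/asboolP; exists (fun j => v (lift i j)); apply: (spanning_drop sv ri r0).
have phi_inj : injective phi.
  move=> r s rs; apply/eqP; rewrite -subr_eq0; apply/eqP/phi0.
  by rewrite addrC -scaleN1r phi_lin scaleN1r rs addNr.
have [psi psiE] := boolp.choice sv.
have psiK x : phi (psi x) = x by rewrite [RHS]psiE.
have phiK r : psi (phi r) = r by apply: phi_inj; rewrite psiK.
exists psi; last by exists phi.
by move=> k x y; apply: phi_inj; rewrite phi_lin !psiK.
Qed.

Lemma span_seqP (E : seq V) x :
  span [set` E] x -> exists r : 'rV[F]_(size E), x = \sum_i r 0 i *: E`_i.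
Proof.
move: x; apply: (@span_min _ _ _ [set x | exists r : 'rV[F]_(size E), _]) =>
  [|x /= xE].
  split=> [|k x y [r ->] [t ->]] /=.
    by exists 0; rewrite big1 // => j _; rewrite mxE scale0r.
  exists (k *: r + t); rewrite scaler_sumr -big_split.
  by apply: eq_bigr => j _; rewrite !mxE scalerDl scalerA.
have ix : (index x E < size E)%N by rewrite index_mem.
exists (delta_mx 0 (Ordinal ix));
  rewrite (bigD1 (Ordinal ix)) //= !mxE !eqxx scale1r.
rewrite nth_index // big1 ?addr0 // => j jx.
by rewrite !mxE (negPf jx) andbF scale0r.
Qed.

Lemma span_consP c (E : seq V) x : span [set` c :: E] x ->
  exists k e, span [set` E] e /\ x = k *: c + e.
Proof.
have EP := span_submodule [set` E]; move: x.
apply: (@span_min _ _ _ [set x | exists k e, span [set` E] e /\ x = k *: c + e]).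
  split=> [|k x y [a [e [Ee ->]]] [b [f [Ef ->]]]] /=.
    by exists 0, 0; rewrite scale0r addr0; split=> //; apply: EP.1.
  exists (k * a + b), (k *: e + f); split; first exact: EP.2.
  by rewrite scalerDr scalerA scalerDl addrACA.
move=> x /=; rewrite inE => /predU1P[->|xE].
  by exists 1, 0; rewrite scale1r addr0; split=> //; apply: EP.1.
by exists 0, x; rewrite scale0r add0r; split=> //; apply: sub_span.
Qed.

(** Exchange argument: a finite family spanning [U] modulo [W] can be replaced
    by one contained in [U]. *)
Lemma finite_span_inside (E : seq V) (U W : set V) : submodule U -> submodule W ->
    (forall x, U x -> exists2 e, span [set` E] e & W (x - e)) ->
  exists E' : seq V, (forall y, y \in E' -> U y) /\
    forall x, U x -> exists2 e, span [set` E'] e & W (x - e).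
Proof.
move=> UP WP; elim: E U UP => [|c E IH] U UP hU.
  by exists [::]; split.
have EP := span_submodule [set` E].
pose U' := [set x | U x /\ exists2 e, span [set` E] e & W (x - e)].
have U'P : submodule U'.
  split=> [|k x y [Ux [e Ee We]] [Uy [f Ef Wf]]].
    by split; [apply: UP.1|exists 0; [apply: EP.1|rewrite subrr; apply: WP.1]].
  split; first exact: UP.2.
  exists (k *: e + f); first exact: EP.2.
  by rewrite opprD addrACA -scalerBr; apply: WP.2.
have [|E' [E'U' hE']] := IH U' U'P; first by move=> x [].
have [UU'|/existsNP[u /not_implyP[Uu U'u]]] := pselect (U `<=` U').
  by exists E'; split=> [y /E'U'[]|x /UU'/hE'].
exists (u :: E'); split=> [y|x Ux].
  by rewrite inE => /predU1P[->|/E'U'[]].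
have [_ /span_consP[k [e [Ee ->]]] Wu] := hU u Uu.
have [_ /span_consP[l [f [Ef ->]]] Wx] := hU x Ux.
have k0 : k != 0.
  apply/eqP => k0; apply: U'u; split=> //; exists e => //.
  by move: Wu; rewrite k0 scale0r add0r.
have [|g E'g Wg] := hE' (- (l / k) *: u + x).
  split; first exact: UP.2.
  exists (- (l / k) *: e + f); first exact: EP.2.
  have -> : - (l / k) *: u + x - (- (l / k) *: e + f) =
      - (l / k) *: (u - (k *: c + e)) + (x - (l *: c + f)).
    rewrite scalerBr scalerDr scalerA mulNr divfK // (scaleNr l).
    by rewrite [RHS]addrACA -opprD (addrACA (- _) _ _ f) addNr add0r.
  exact: WP.2.
have E'P := span_submodule [set` u :: E'].
exists ((l / k) *: u + g).
  apply: E'P.2; first by apply: sub_span; rewrite /= inE eqxx.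
  by apply: (span_mono _ E'g) => z /= zE'; rewrite inE zE' orbT.
by move: Wg; rewrite scaleNr opprD addrA (addrC x).
Qed.

End FiniteDimension.

Lemma fin_dim_subquot (F : fieldType) (V : lmodType F) (U W : subspace V) (E :
  seq V) :
  (forall x, subspace_set U x -> exists2 e, span [set` E] e & subspace_set W (x -
    e)) ->
  fin_dim (subquot U W).
Proof.
have UP : submodule U by apply/submoduleP/subspaceP.
have WP : submodule W by apply/submoduleP/subspaceP.
move=> /(finite_span_inside UP WP)[{}E [EU hE]].
have inU x : subspace_set U x -> x \in subspace_pred U by move=> Ux; apply/mem_set.
pose lift_U x : subspace_type U := insubd 0 x.
have lift_UE x : subspace_set U x -> val (lift_U x) = x.
  by move=> /inU Ux; rewrite /lift_U val_insubd Ux.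
set W' := Subspace (sub_inter_submod_closed U W).
apply: (@spanning_fin_dim F (quot_mod W') (size E) (fun i =>
  quot_pi W' (lift_U E`_i))) => q.
have [x ->] : exists x, q = quot_pi W' x by exists (repr q); rewrite /quot_pi reprK.
have Ux : subspace_set U (val x) by apply/set_mem/(valP x).
have [_ /span_seqP[r ->] Wx] := hE _ Ux; exists r.
have piZ k y : quot_pi W' (k *: y) = k *: quot_pi W' y by exact:
  (esym (@quot_scaleE _ _ W' k y)).
have pi_sum (P : pred 'I_(size E)) (f : 'I_(size E) -> subspace_type U) :
    \sum_(i | P i) quot_pi W' (f i) = quot_pi W' (\sum_(i | P i) f i).
  elim/big_rec2: _ => [|i y z _ ->]; last by rewrite quot_piD.
  by apply/esym/quot_pi_eq0; apply: (submod0 (proj2 (submoduleP _) (subspaceP W'))).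
under [RHS]eq_bigr do rewrite -piZ.
rewrite pi_sum; apply/eqP; rewrite -subr_eq0 -scaleN1r -piZ -quot_piD scaleN1r.
apply/eqP/quot_pi_eq0.
change (subspace_set W (val (x - \sum_i r 0 i *: lift_U E`_i))).
suff -> : val (x - \sum_i r 0 i *: lift_U E`_i) = val x - \sum_i r 0 i *:
  E`_i by [].
rewrite raddfB raddf_sum; congr (_ - _); apply: eq_bigr => i _.
have UE : subspace_set U E`_i by apply: EU; apply: mem_nth.
by rewrite -[in RHS](lift_UE _ UE); apply: linearZ.
Qed.

(** * The generic points of the one-dimensional components *)

Lemma linear_dependence (F : fieldType) (A : algType F) (E : seq A) n
    (a : 'I_n -> A) : (size E < n)%N -> (forall i, span [set` E] (a i)) ->
  exists2 c : 'I_n -> F, exists i, c i != 0 & \sum_i c i *: a i = 0.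
Proof.
move=> En aE.
pose r i := sval (cid (span_seqP (aE i))).
have rE i : a i = \sum_j r i 0 j *: E`_j by rewrite /r; case: cid.
pose M := \matrix_(i < n) r i.
have : kermx M != 0.
  rewrite kermx_eq0 /row_free; apply: contraTneq En => rk.
  by rewrite -leqNgt -rk rank_leq_col.
case/rowV0Pn => u /sub_kermxP uM u0; exists (fun i => u 0 i).
  apply/existsP; apply: contraNT u0 => /existsPn u0; apply/eqP/rowP => i.
  by rewrite mxE; apply/eqP; have := u0 i; rewrite negbK.
under eq_bigr do rewrite rE scaler_sumr.
rewrite exchange_big big1 // => j _ /=.
under eq_bigr do rewrite scalerA.
rewrite -scaler_suml; have /rowP/(_ j) := uM; rewrite !mxE.
by under eq_bigr do rewrite mxE; move=> ->; rewrite scale0r.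
Qed.

(** The homogeneous form of degree [N] in two variables that corresponds to the
    polynomial [f], with [y] in the place of the variable of [f]. *)
Definition form (A : algType rat) (x y : A) N (f : {poly rat}) : A :=
  \sum_(i < N.+1) f`_i *: (x ^+ (N - i) * y ^+ i).

Section Form.
Variable A : algType rat.
Implicit Types (x y z : A) (f : {poly rat}) (J P : set A).

Lemma comm_expr_mod J z x n :
  two_sided_ideal J -> J (comm z x) -> J (comm z (x ^+ n)).
Proof.
move=> JP Jx; elim: n => [|n IH]; first by rewrite comm1r; apply: (ideal0 JP).
rewrite exprS commMr; apply: (idealD JP); first exact: (idealMr JP).
exact: (idealMl JP).
Qed.

Lemma comm_expr_deriv J z y n : two_sided_ideal J -> lcs_ideal A 3 `<=` J ->
  J (comm z (y ^+ n.+1) - (y ^+ n * comm z y) *+ n.+1).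
Proof.
move=> JP J3; elim: n => [|n IH]; first by rewrite mul1r subrr; apply: (ideal0 JP).
rewrite exprSr commMr mulrS addrKA.
have -> : (y ^+ n.+1 * comm z y) *+ n.+1 =
    (y ^+ n * comm z y) *+ n.+1 * y + (y ^+ n * comm y (comm z y)) *+ n.+1.
  rewrite mulrnAl -mulrnDl; congr (_ *+ _).
  by rewrite exprSr -!mulrA -mulrDr -mul_commE.
rewrite opprD addrA -mulrBl; apply: (idealB JP); first exact: (idealMr JP).
rewrite -mulrnAr -mulr_natl; apply: (idealMl JP); apply: (idealMl JP).
exact: comm3_ideal.
Qed.

(** Leibniz rule: commutation with [z] acts on a form like a derivation. *)
Lemma comm_form J z x y N f : two_sided_ideal J -> lcs_ideal A 3 `<=` J ->
  J (comm z x) -> J (comm z (form x y N.+1 f) - form x y N f^`() * comm z y).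
Proof.
move=> JP J3 Jx; rewrite /form big_ord_recl commDr -addrA; apply: (idealD JP).
  by rewrite mulr1 commZr; apply: (idealZ JP); apply: comm_expr_mod.
have commsum (r : seq 'I_N.+1) (E : 'I_N.+1 -> A) :
    comm z (\sum_(i <- r) E i) = \sum_(i <- r) comm z (E i).
  by elim/big_rec2: _ => [|i u v _ <-]; rewrite ?comm0r ?commDr.
rewrite commsum mulr_suml -sumrB; apply: (submod_sum (ideal_submodule JP)) => i _.
rewrite coef_deriv lift0 subSS -scalerMnl scalerMnr.
rewrite commZr -scalerAl -scalerBr; apply: (idealZ JP).
rewrite commMr mulrnAl -addrA; apply: (idealD JP).
  by apply: (idealMr JP); apply: comm_expr_mod.
by rewrite -mulrA -mulrnAr -mulrBr; apply: (idealMl JP); apply: comm_expr_deriv.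
Qed.

(** Take a relation of minimal degree. In characteristic zero its derivative is
    nonzero, since a constant relation would put a power of [x] into [P]; being of
    smaller degree, it is not a relation. *)
Lemma separable_relation P x y N f : central_prime P -> ~ P x ->
    f != 0 -> (size f <= N.+1)%N -> P (form x y N f) ->
  exists M g, P (form x y M.+1 g) /\ ~ P (form x y M g^`()).
Proof.
move=> PP Px; have [n] := ubnP (size f); elim: n f N => [//|n IH] f N sn f0 sN Pf.
have [f'0|f'0] := eqVneq f^`() 0.
  have fC : f = (f`_0)%:P.
    apply/polyP=> i; rewrite coefC; case: i => [//|i] /=;
      have /eqP := congr1 (fun p : {poly rat} => p`_i) f'0.
    by rewrite coef_deriv coef0 Num.Theory.mulrn_eq0 => /eqP.
  have c0 : f`_0 != 0 by apply: contra f0 => /eqP c0; rewrite fC c0.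
  case: Px; apply: (cprime_exp (n := N) PP).
  have -> : x ^+ N = (f`_0)^-1 *: form x y N f.
    rewrite /form big_ord_recl big1 => [|i _]; last by rewrite fC coefC scale0r.
    by rewrite addr0 mulr1 subn0 scalerA mulVf ?scale1r.
  exact: (idealZ (cprime_ideal PP)).
have sf' := lt_size_deriv f0.
case: N sN Pf => [|N] sN Pf.
  by have := leq_trans sf' sN; rewrite ltnS leqn0 size_poly_eq0 (negPf f'0).
case: (pselect (P (form x y N f^`()))) => [Pf'|nPf']; last by exists N, f.
by apply: (IH f^`() N) => //; [apply: leq_trans sf' _|rewrite -ltnS;
  apply: leq_trans sf' _].
Qed.

End Form.

Section Adjoin.
Variables (F : fieldType) (A : algType F).

Lemma ideal_gen_adjoin (P : set A) t z :
  two_sided_ideal P -> lcs_ideal A 2 `<=` P ->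
  ideal_gen (P `|` [set t]) z -> exists a, P (z - t * a).
Proof.
move=> IP P2; move: z;
  apply: (@ideal_gen_min _ _ _ [set z | exists a, P (z - t * a)]).
  split=> [|u v [a Pu] [b Pv]|b u [a Pu]] /=.
  - by exists 0; rewrite mulr0 subrr; apply: (ideal0 IP).
  - by exists (a + b); rewrite mulrDr opprD addrACA; apply: (idealD IP).
  split; last by exists (a * b); rewrite mulrA -mulrBl; apply: (idealMr IP).
  exists (b * a); have -> : b * u - t * (b * a) = b * (u - t * a) + comm b t * a.
    by rewrite /comm mulrBr mulrBl !mulrA addrA subrK.
  apply: (idealD IP); first exact: (idealMl IP).
  by apply: (idealMr IP); apply: P2; apply: comm_lcs_ideal2.
move=> z [Pz|->] /=; first by exists 0; rewrite mulr0 subr0.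
by exists 1; rewrite mulr1 subrr; apply: (ideal0 IP).
Qed.

End Adjoin.

Section GenericPoint.
Variables (A : algType rat) (gr : nat -> set A).
Hypothesis hgr : is_grading gr.
Hypothesis hgen : generates (gr 1).
Variable Y : seq A.
Hypothesis gY : generates [set` Y].
Hypothesis Y1 : forall y, y \in Y -> gr 1 y.
Hypothesis hdim : krull_dim_le (abelianization A) 1.
Variable P : set A.
Hypothesis PP : central_prime P.
Hypothesis Phom : homogeneous hgr P.
Variable x : A.
Hypothesis x1 : gr 1 x.
Hypothesis Px : ~ P x.

Let IP : two_sided_ideal P := cprime_ideal PP.
Let P2 : lcs_ideal A 2 `<=` P := cprime_comm PP.

(** In dimension one there is no homogeneous prime strictly between [P] and the
    irrelevant ideal; so [P] and [x] generate an ideal whose radical is the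
    irrelevant ideal. *)
Lemma generator_nilpotent_adjoin y : gr 1 y ->
  exists n, ideal_gen (P `|` [set x]) (y ^+ n).
Proof.
move=> y1; apply: contrapT => /forallNP nI.
set I := ideal_gen _ in nI;
  have II : two_sided_ideal I by apply: ideal_gen_two_sided.
have PI : P `<=` I by move=> z Pz; apply: sub_ideal_gen; left.
have [||||Q [QQ IQ QU]] :=
  @central_prime_exists _ _ I [set u | exists n, u = y ^+ n] II.
- by move=> z /P2/PI.
- by exists 0%N.
- by move=> _ _ [m ->] [n ->]; exists (m + n)%N; rewrite exprD.
- by move=> _ [n ->]; apply: nI.
have Ihom : homogeneous hgr I.
  apply: ideal_gen_homogeneous => z [/Phom Pz i|-> i]; first by apply: PI.
  rewrite (homog_grE hgr i x1); case: eqP => _; last exact: (ideal0 II).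
  by apply: sub_ideal_gen; right.
have QP := star_central_prime hgr QQ.
have Qhom : homogeneous hgr (star hgr Q).
  by apply: star_homogeneous; apply: ideal_submodule; apply: cprime_ideal.
have sI z : I z -> star hgr Q z by move=> /Ihom Iz i; apply: IQ.
have [||QP'|] := krull_dim1_chain hdim PP QP (irrelevant_prime hgr hgen).
- by move=> z /PI/sI.
- exact: homogeneous_sub_irrelevant.
- by apply: Px; apply: QP'; apply: sI; apply: sub_ideal_gen; right.
- move=> /(_ y (gr1_irrelevant hgr y1)) sy; apply: (QU y); first by exists 1%N.
  exact: (star_sub (ideal_submodule (cprime_ideal QQ)) sy).
Qed.

(** Long words lie in the ideal generated by [P] and [x]; comparing homogeneous
    components, the cofactor of [x] can be taken of smaller degree, and the
    division can be repeated. *)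
Lemma eventually_divisible : exists N, forall m z, gr (N + m) z ->
  exists a, gr N a /\ P (z - x ^+ m * a).
Proof.
set I := ideal_gen (P `|` [set x]).
have PI : P `<=` I by move=> z Pz; apply: sub_ideal_gen; left.
have II : two_sided_ideal I by apply: ideal_gen_two_sided.
have [|y yY|N hN] := @long_words_in_ideal _ _ Y I II.
- by move=> z /P2/PI.
- by apply: generator_nilpotent_adjoin; apply: Y1.
exists N; elim=> [|m IH] z.
  by rewrite addn0 => gz; exists z; rewrite mul1r subrr; split=> //;
    apply: (ideal0 IP).
rewrite addnS => gz; have : I z.
  apply: span_min (gr_words_span hgr gY Y1 gz) => [|w];
    first exact: ideal_submodule.
  by apply: hN; rewrite leqW // leq_addr.
move=> /(ideal_gen_adjoin IP P2)[b Pb].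
have Pc : P (z - x * (homog hgr b)`_(N + m)).
  have := Phom Pb (1 + (N + m))%N.
  rewrite -scaleN1r homogD coefD homogZ (homog_grM hgr _ _ x1).
  by rewrite (homog_grE hgr _ gz) add1n eqxx scaleN1r.
have [a [ga Pa]] := IH _ (homog_graded hgr b (N + m)).
exists a; split=> //; rewrite exprS -mulrA.
apply: (ideal_sub IP (y := x * (homog hgr b)`_(N + m) - x * (x ^+ m * a))).
  by rewrite opprB addrA subrK.
by rewrite -mulrBr; apply: (idealMl IP).
Qed.

(** The graded quotient by [P] has bounded dimensions, so that two elements of
    degree one satisfy a homogeneous equation. *)
Lemma exists_relation y : gr 1 y -> exists N (f : {poly rat}),
  [/\ f != 0, (size f <= N.+1)%N & P (form x y N f)].
Proof.
move=> y1; have [N0 hN] := eventually_divisible.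
(* [N + 1] monomials of degree [N] lie modulo [P] in [x ^ B * gr N0], which is
   spanned by [B <= N] elements *)
set B := size (words Y N0); set N := (N0 + B)%N.
have [|a aP] := @boolp.choice 'I_N.+1 A (fun i a =>
    gr N0 a /\ P (x ^+ (N - i) * y ^+ i - x ^+ B * a)).
  move=> i; apply: hN; rewrite -/N.
  suff: gr (1 * (N - i) + 1 * i) (x ^+ (N - i) * y ^+ i).
    by rewrite !mul1n subnK // -ltnS ltn_ord.
  by apply: (gr_mul hgr); apply: (grX hgr).
have [||c [i0 ci0] c0] := @linear_dependence _ _ (words Y N0) N.+1 a.
- by rewrite ltnS leq_addl.
- by move=> i; apply: (gr_words_span hgr gY Y1); apply: (aP i).1.
exists N, (\poly_(i < N.+1) c (inord i)); split; last 1 first.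
- rewrite /form; under eq_bigr => i _ do rewrite coef_poly ltn_ord inord_val.
  have -> : \sum_(i < N.+1) c i *: (x ^+ (N - i) * y ^+ i) =
      \sum_(i < N.+1) c i *: (x ^+ (N - i) * y ^+ i - x ^+ B * a i).
    under [RHS]eq_bigr => i _ do rewrite scalerBr [X in _ - X]scalerAr.
    by rewrite sumrB -mulr_sumr c0 mulr0 subr0.
  apply: (submod_sum (ideal_submodule IP)) => i _.
  by apply: (idealZ IP); apply: (aP i).2.
- apply: contraNneq ci0 => /(congr1 (fun p : {poly rat} => p`_i0)).
  by rewrite coef_poly ltn_ord inord_val coef0 => ->.
- exact: size_poly.
Qed.

Hypothesis hred : finite_set (nonreduced_points (abelianization A)).

(** An equation [1 = (x - d) * g] modulo [P] determines the component of [g] of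
    each degree [i] as a nonzero multiple of [x ^+ i], and these never vanish. *)
Lemma shifted_adjoin_proper (d : rat) : d != 0 ->
  ~ ideal_gen (P `|` [set x - d *: 1]) 1.
Proof.
move=> d0 /(ideal_gen_adjoin IP P2)[g Pg].
set e := 1 - _ in Pg; have eE : e = 1 + (d *: g + (-1) *: (x * g)).
  by rewrite /e mulrBl -scalerAl mul1r opprB scaleN1r.
have P0 : P (1 + d *: (homog hgr g)`_0).
  have := Phom Pg 0%N; rewrite eE !homogD !coefD !homogZ homogM coef0M.
  by rewrite !(homog_grE hgr _ x1) (homog_grE hgr _ (gr_one hgr)) mul0r scaler0
    addr0.
have PS i : P (d *: (homog hgr g)`_i.+1 - x * (homog hgr g)`_i).
  have xgE : (homog hgr (x * g))`_i.+1 = x * (homog hgr g)`_i.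
    exact: (homog_grM hgr g i x1).
  have := Phom Pg i.+1; rewrite eE !homogD !coefD !homogZ xgE.
  by rewrite (homog_grE hgr _ (gr_one hgr)) add0r scaleN1r.
have Pi i : P (d ^+ i.+1 *: (homog hgr g)`_i + x ^+ i).
  elim: i => [|i IH]; first by rewrite addrC.
  have -> : d ^+ i.+2 *: (homog hgr g)`_i.+1 + x ^+ i.+1 =
      d ^+ i.+1 *: (d *: (homog hgr g)`_i.+1 - x * (homog hgr g)`_i) +
      x * (d ^+ i.+1 *: (homog hgr g)`_i + x ^+ i).
    by rewrite scalerBr scalerA -exprSr mulrDr -scalerAr -exprS addrA subrK.
  by apply: (idealD IP); [apply: (idealZ IP)|apply: (idealMl IP)].
apply: Px; apply: (cprime_exp (n := size (homog hgr g)) PP).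
by have := Pi (size (homog hgr g)); rewrite nth_default // scaler0 add0r.
Qed.

(** A nilpotent that survives at [P] would survive at the infinitely many primes
    that contain [P] and some [x - d], so [P] is a reduced point; it is also
    minimal, hence its local ring is a field. *)
Lemma local_ring_field p : P p -> exists2 s, ~ P s & lcs_ideal A 2 (s * p).
Proof.
move=> Pp; apply: contrapT => nsp.
have sp s : ~ P s -> ~ lcs_ideal A 2 (s * p) by move=> Ps Ms; apply: nsp; exists s.
have M2P := lcs_idealP (A := A) 2.
have PM a b : ~ P a -> ~ P b -> ~ P (a * b).
  by move=> Pa Pb /(cprime_mul PP)[].
have Phomog := homogeneous_sub_irrelevant hgen PP Phom.
have [s [n [Ps Msn]]] : exists s n, ~ P s /\ lcs_ideal A 2 (s * p ^+ n).
  apply: contrapT => nU.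
  pose U : set A := [set u | exists s n, ~ P s /\ ab_pr u = ab_pr (s * p ^+ n)].
  have [//|||u|Q [QQ _ QU]] := @central_prime_exists _ _ (lcs_ideal A 2) U M2P.
  - by exists 1, 0%N; rewrite mulr1; split=> //; apply: (cprime_proper PP).
  - move=> u v [s [m [Ps eu]]] [t [n [Pt ev]]]; exists (s * t), (m + n)%N.
    by split; [apply: PM|rewrite ab_prM eu ev !ab_prM !ab_prX mulrACA -exprD].
  - move=> [s [n [Ps eu]]] /ab_pr_eq0; rewrite eu => /ab_pr_eq0 Ms.
    by apply: nU; exists s, n.
  (* a prime that avoids the powers of [p] and lies in [P] would make a chain of
     length two together with the irrelevant ideal *)
  have QP : Q `<=` P.
    move=> z Qz; apply: contrapT => Pz; apply: (QU z) => //.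
    by exists z, 0%N; rewrite mulr1.
  have [||PQ|irrP] := krull_dim1_chain hdim QQ PP (irrelevant_prime hgr hgen) => //.
    apply: (QU p); last exact: PQ.
    by exists 1, 1%N; rewrite mul1r; split=> //; apply: (cprime_proper PP).
  by apply: Px; apply: irrP; apply: gr1_irrelevant.
(* [s * p] is nilpotent in [X] itself and still survives at [P] *)
pose q := s * p.
have q0 : ab_pr q ^+ n.+1 = 0.
  rewrite ab_prM exprMn exprSr [ab_pr p ^+ _]exprS -mulrA [ab_pr s * _]mulrCA.
  have -> : ab_pr s * ab_pr p ^+ n = 0 by rewrite -ab_prX -ab_prM; apply/ab_pr_eq0.
  by rewrite !mulr0.
have ex c : exists r : Spec (abelianization A),
    [/\ ~ reduced (local_ring r), spec_set r (ab_pr (x - c.+1%:R *: 1)) &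
      forall c', spec_set r (ab_pr (x - c'.+1%:R *: 1)) -> c = c'].
  set d : rat := c.+1%:R; have d0 : d != 0 by rewrite Num.Theory.pnatr_eq0.
  set I := ideal_gen (P `|` [set x - d *: 1]).
  have PI : P `<=` I by move=> z Pz; apply: sub_ideal_gen; left.
  have [|||u|Q [QQ IQ _]] :=
    @central_prime_exists _ _ I [set 1] (ideal_gen_two_sided _).
  - by move=> z /P2/PI.
  - by [].
  - by move=> _ _ -> ->; rewrite /= mulr1.
  - by move=> ->; apply: shifted_adjoin_proper.
  have Qxd : Q (x - d *: 1) by apply: IQ; apply: sub_ideal_gen; right.
  have QP := cprime_ideal QQ.
  have [r rE] := spec_of_central_prime QQ; exists r; split; last 2 first.
  - exact/rE.
  - move=> c' /rE/(idealB QP)/(_ Qxd); rewrite opprB addrC addrA subrK -scalerBl.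
    move=> Qe; apply: contrapT => /eqP cc'; apply: (cprime_proper QQ).
    have e0 : d - c'.+1%:R != 0.
      by rewrite subr_eq0 Num.Theory.eqr_nat eqSS.
    by rewrite -[1]scale1r -(mulVf e0) -scalerA; apply: (idealZ QP).
  apply: (nonreduced_local_ring q0) => t; have [t' ->] := ab_prP t.
  rewrite rE => Qt /eqP; rewrite -ab_prM => /eqP/ab_pr_eq0; rewrite mulrA;
    apply: sp.
  by apply: PM => // /PI/IQ.
have [r rP] := boolp.choice ex.
apply: infinite_nat.
have <- : r @^-1` nonreduced_points (abelianization A) = setT.
  by rewrite eqEsubset; split=> // c _; case: (rP c).
apply: finite_preimage hred => c c' _ _ rcc'.
by have [_ _] := rP c; apply; rewrite rcc'; case: (rP c').
Qed.

End GenericPoint.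

(** * The conductor of the commutator ideal *)

Section Conductor.
Variables (A : algType rat) (gr : nat -> set A).
Hypothesis hgr : is_grading gr.
Hypothesis hgen : generates (gr 1).
Variable Y : seq A.
Hypothesis gY : generates [set` Y].
Hypothesis Y1 : forall y, y \in Y -> gr 1 y.
Hypothesis hdim : krull_dim_le (abelianization A) 1.
Hypothesis hred : finite_set (nonreduced_points (abelianization A)).
Implicit Types (x y z : A) (P I : set A).

Lemma unramified_at_prime P x y : central_prime P -> homogeneous hgr P ->
  gr 1 x -> ~ P x -> gr 1 y -> unramified_over [set s | ~ P s] x y.
Proof.
move=> PP Phom x1 Px y1.
have [N [f [f0 sf Pf]]] := exists_relation hgen gY Y1 hdim PP Phom x1 Px y1.
have [M [g [Pg Pg']]] := separable_relation PP Px f0 sf Pf.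
have [s Ps Ms] := local_ring_field hgen hdim PP Phom x1 Px hred Pg.
exists (form x y M.+1 g), (form x y M g^`()), s; split=> // J z JP J3 Jzx.
exact: comm_form.
Qed.

Definition conductor k : set A :=
  [set a | forall m, lcs_ideal A 2 m -> lcs_ideal A k (a * m) /\ lcs_ideal A k (m
    * a)].

Lemma conductor_ideal k : two_sided_ideal (conductor k).
Proof.
have MP := lcs_idealP (A := A) k; have M2P := lcs_idealP (A := A) 2.
split=> [m _|x y hx hy m Mm|a x hx].
- by rewrite mul0r mulr0; split; apply: (ideal0 MP).
- rewrite mulrDl mulrDr; have [? ?] := hx m Mm; have [? ?] := hy m Mm.
  by split; apply: (idealD MP).
- split=> m Mm; split.
  + by rewrite -mulrA; apply: (idealMl MP); apply: (hx m Mm).1.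
  + by rewrite mulrA; apply: (hx _ (idealMr M2P a Mm)).2.
  + by rewrite -mulrA; apply: (hx _ (idealMl M2P a Mm)).1.
  + by rewrite mulrA; apply: (idealMr MP); apply: (hx m Mm).2.
Qed.

Lemma lcs_ideal_conductor k : lcs_ideal A k `<=` conductor k.
Proof.
have MP := lcs_idealP (A := A) k.
by move=> x Mx m _; split; [apply: (idealMr MP)|apply: (idealMl MP)].
Qed.

(** [M_2] and [M_k] are homogeneous, so membership in the conductor can be tested
    on homogeneous elements of [M_2]; for these the components of [a * m] are the
    products of [m] with the components of [a]. *)
Lemma conductor_homogeneous k : homogeneous hgr (conductor k).
Proof.
have MP := ideal_submodule (lcs_idealP (A := A) k).
move=> a ca i m Mm; rewrite (homog_sum hgr m) mulr_sumr mulr_suml.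
split; apply: (submod_sum MP) => j _; set n := nat_of_ord j;
  have Mn := lcs_ideal_homogeneous hgr Mm n.
- rewrite -(homogMgr hgr a i (homog_graded hgr m n)).
  exact: lcs_ideal_homogeneous (ca _ Mn).1 _.
- rewrite -(homog_grM hgr a i (homog_graded hgr m n)).
  exact: lcs_ideal_homogeneous (ca _ Mn).2 _.
Qed.

(** No homogeneous prime other than the irrelevant ideal contains the conductor:
    at such a prime all commutators are torsion modulo [M_k], and finitely many
    of them generate [M_2]. *)
Lemma conductor_not_in_prime k P x : central_prime P -> homogeneous hgr P ->
  gr 1 x -> ~ P x -> exists2 s, ~ P s & conductor k.+2 s.
Proof.
move=> PP Phom x1 Px; pose S : set A := [set s | ~ P s].
have S1 : S 1 by apply: cprime_proper.
have SM s t : S s -> S t -> S (s * t) by move=> Ss St /(cprime_mul PP)[].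
have sT := torsion_mod_saturated k.+1 S1 SM.
have Tc : forall a b, torsion_mod S k.+1 (comm a b).
  apply: (@local_commutative _ _ S Y x gY _ k) => // [y yY|z Mz].
    by apply: unramified_at_prime => //; apply: Y1.
  by exists 1; rewrite ?mul1r.
have [|s Ss sM] := @torsion_uniform _ _ S k.+1 S1 SM [seq comm y z | y <- Y, z <-
  Y].
  by move=> _ /allpairsP[p [_ _ ->]]; apply: Tc.
exists s => // m Mm; apply: sM; move: m Mm.
have gP := ideal_gen_two_sided [set` [seq comm y z | y <- Y, z <- Y]].
apply: lcs_ideal2_min => //; apply: (commutative_mod gY gP) => y z Yy Yz.
by apply: sub_ideal_gen; apply/allpairsP; exists (y, z).
Qed.

(** Otherwise a homogeneous prime would contain the conductor and not [y]. *)
Lemma generator_nilpotent_conductor k y : gr 1 y ->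
  exists n, ideal_gen (conductor k.+2 `|` lcs_ideal A 2) (y ^+ n).
Proof.
move=> y1; apply: contrapT => /forallNP nI.
set I := ideal_gen _ in nI;
  have II : two_sided_ideal I by apply: ideal_gen_two_sided.
have CI : conductor k.+2 `<=` I by move=> z Cz; apply: sub_ideal_gen; left.
have MI : lcs_ideal A 2 `<=` I by move=> z Mz; apply: sub_ideal_gen; right.
have [//||||Q [QQ IQ QU]] :=
  @central_prime_exists _ _ I [set u | exists n, u = y ^+ n] II.
- by exists 0%N.
- by move=> _ _ [m ->] [n ->]; exists (m + n)%N; rewrite exprD.
- by move=> _ [n ->]; apply: nI.
have Ihom : homogeneous hgr I.
  apply: ideal_gen_homogeneous =>
    z [/conductor_homogeneous Cz|/(lcs_ideal_homogeneous hgr) Mz] i.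
    by apply: CI; apply: Cz.
  by apply: MI; apply: Mz.
have QP := star_central_prime hgr QQ.
have QI := ideal_submodule (cprime_ideal QQ).
have [|s sQ /CI/Ihom sI] := conductor_not_in_prime k QP (star_homogeneous QI) y1.
- by move=> /(star_sub QI); apply: QU; exists 1%N.
- by apply: sQ => i; apply: IQ; apply: sI.
Qed.

(** Long words lie in the sum of the conductor and [M_2]; a product of many
    elements of [M_2] lies in [M_k], so that even longer words lie in the
    conductor. *)
Lemma long_words_in_conductor k : exists N, forall n w,
  (N <= n)%N -> w \in words Y n -> conductor k.+2 w.
Proof.
set C := conductor k.+2; have CP : two_sided_ideal C := conductor_ideal k.+2.
set M := lcs_ideal A 2; have MP : two_sided_ideal M := lcs_idealP 2.
have [|y yY|N hN] := @long_words_in_ideal _ _ Y _ (ideal_gen_two_sided (C `|` M)).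
- by move=> z Mz; apply: sub_ideal_gen; right.
- by apply: generator_nilpotent_conductor; apply: Y1.
have sumP z : ideal_gen (C `|` M) z -> exists2 m, M m & C (z - m).
  move: z; apply: (@ideal_gen_min _ _ _ [set z | exists2 m, M m & C (z - m)]).
    split=> [|u v [m Mm Cm] [n Mn Cn]|a u [m Mm Cm]] /=.
    - by exists 0; [apply: (ideal0 MP)|rewrite subrr; apply: (ideal0 CP)].
    - exists (m + n); first exact: (idealD MP).
      by rewrite opprD addrACA; apply: (idealD CP).
    - split; [exists (a * m)|exists (m * a)].
      + exact: (idealMl MP).
      + by rewrite -mulrBr; apply: (idealMl CP).
      + exact: (idealMr MP).
      + by rewrite -mulrBl; apply: (idealMr CP).
  move=> z [Cz|Mz]; first by exists 0; [apply: (ideal0 MP)|rewrite subr0].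
  by exists z => //; rewrite subrr; apply: (ideal0 CP).
have [r nM] := nil_lcs_ideal k.+2 gY.
exists (r * N)%N => n w /subnKC <-; move: (n - _)%N => {}n wY.
suff [s [t [sr sM Cw]]] : exists s t, [/\ size s = r, forall x, x \in s -> M x
    & C (w - \prod_(x <- s) x * t)].
  apply: (ideal_sub CP Cw); apply: (idealMr CP).
  by apply: lcs_ideal_conductor; apply: nM.
elim: (r) w wY => [|q IH] w; first by move=> _; exists [::], w;
  rewrite big_nil mul1r subrr; split=> //; apply: (ideal0 CP).
rewrite mulSn -addnA => /words_splitP[u [v [uN /IH[s [t [sq sM Cv]]] ->]]].
have [m Mm Cu] := sumP u (hN N u (leqnn N) uN).
exists (m :: s), t; split=> [|x|]; first by rewrite /= sq.
  by rewrite inE => /predU1P[->|/sM].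
rewrite big_cons.
have -> : u * v - m * \prod_(x <- s) x * t =
    (u - m) * v + m * (v - \prod_(x <- s) x * t).
  by rewrite mulrBl mulrBr !mulrA addrA subrK.
by apply: (idealD CP); [apply: (idealMr CP)|apply: (idealMl CP)].
Qed.

(** * Finiteness *)

Definition finite_mod (U W : set A) : Prop := exists E : seq A,
  forall x, U x -> exists2 e, span [set` E] e & W (x - e).

Definition short_words n : seq A := flatten [seq words Y i | i <- iota 0 n].

Lemma mem_short_words n i w : (i < n)%N -> w \in words Y i -> w \in short_words n.
Proof. by move=> ni wY; apply/flatten_mapP; exists i; rewrite ?mem_iota. Qed.

Lemma words_ind (W : set A) (f : A -> A) : submodule W ->
  (forall (c : rat) u v, f (c *: u + v) = c *: f u + f v) ->
  (forall n w, w \in words Y n -> W (f w)) -> forall x, W (f x).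
Proof.
move=> WP flin fW x; have := words_span x gY; move: x.
apply: (@span_min _ _ _ [set x | W (f x)]) => [|w [n]]; last exact: fW.
have f0 : f 0 = 0.
  by apply: (@addrI _ (f 0)); rewrite addr0 -{1}[f 0]scale1r -flin scaler0 addr0.
split=> [|c u v Wu Wv] /=; first by rewrite f0; apply: WP.1.
by rewrite flin; apply: WP.2.
Qed.

Section Finiteness.
Variables (k N : nat).
Hypothesis long : forall n w, (N <= n)%N -> w \in words Y n -> conductor k.+2 w.

(** A word of length [2 N] is a product of two elements of the conductor, which
    the Leibniz rule multiplies with elements of [M_2]. *)
Lemma comm_long_word n v w : (N + N <= n)%N -> v \in words Y n ->
  lcs_ideal A k.+2 (comm v w).
Proof.
move=> Nn; have -> : n = (N + (n - N))%N by lia.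
move=> /words_splitP[u [u' [uY u'Y ->]]].
have cu := long (leqnn N) uY; have cu' : conductor k.+2 u' by apply: long u'Y; lia.
rewrite commMl; apply: (idealD (lcs_idealP k.+2)).
  exact: (cu _ (comm_lcs_ideal2 _ _)).1.
exact: (cu' _ (comm_lcs_ideal2 _ _)).2.
Qed.

Lemma finite_mod_submodule (E : seq A) (W : set A) : submodule W ->
  submodule [set x | exists2 e, span [set` E] e & W (x - e)].
Proof.
have EP := span_submodule [set` E].
move=> WP; split=> [|c x y [e Ee We] [f Ef Wf]].
  by exists 0; [apply: EP.1|rewrite subrr; apply: WP.1].
exists (c *: e + f); first exact: EP.2.
by rewrite opprD addrACA -scalerBr; apply: WP.2.
Qed.

Lemma finite_mod_ideal : finite_mod (lcs_ideal A 2) (lcs_ideal A k.+2).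
Proof.
have MP := lcs_idealP (A := A) k.+2; have WP := ideal_submodule MP.
set L := short_words (N + N).
pose E := [seq u * c | u <- L, c <- [seq comm v w | v <- L, w <- L]].
exists E; set D := [set x | exists2 e, span [set` E] e & lcs_ideal A k.+2 (x - e)].
have DP : submodule D by apply: finite_mod_submodule.
have DM x : lcs_ideal A k.+2 x -> D x.
  by exists 0; rewrite ?subr0 //; apply: (submod0 (span_submodule _)).
suff Dw : forall u v w, D (u * comm v w).
  suff sD : lcs_ideal A 2 `<=` D by move=> x /sD.
  move=> x /lcs_ideal_span; move: x; apply: span_min => // _ [u [l [l2 ->]]].
  move: l l2; apply: (@lcs_min _ _ _ [set l | D (u * l)]) => [|v w _];
    last exact: Dw.
  split=> [|c x y Dx Dy] /=; first by rewrite mulr0; apply: DP.1.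
  by rewrite mulrDr -scalerAr; apply: DP.2.
move=> u v w; move: u; apply: words_ind => // [c u u'|n u uY].
  by rewrite mulrDl -scalerAl.
move: v; apply: words_ind => // [c v v'|m v vY].
  by rewrite commDl commZl mulrDr -scalerAr.
move: w; apply: words_ind => // [c w w'|l w wY].
  by rewrite commDr commZr mulrDr -scalerAr.
have [Nn|nN] := leqP (N + N) n.
  have cu : conductor k.+2 u by apply: long uY; lia.
  by apply: DM; apply: (cu _ (comm_lcs_ideal2 v w)).1.
have [Nm|mN] := leqP (N + N) m.
  by apply: DM; apply: (idealMl MP); apply: comm_long_word vY.
have [Nl|lN] := leqP (N + N) l.
  apply: DM; apply: (idealMl MP); rewrite commC; apply: (idealN MP).
  exact: comm_long_word wY.
exists (u * comm v w); last by rewrite subrr; apply: WP.1.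
apply: sub_span; apply: allpairs_f; first exact: mem_short_words uY.
by apply: allpairs_f; [apply: mem_short_words vY|apply: mem_short_words wY].
Qed.

(** A long inner word makes the inner commutator an element of [M_{k + 2}],
    whose commutators have large weight when the index is odd; by the Jacobi
    identity a long outer word can be moved inside. *)
Lemma finite_mod_lcs : ~~ odd k.+1 -> finite_mod (lcs A 3) (lcs A k.+3).
Proof.
move=> kodd; have WP := lcs_submodule (A := A) k.+3.
have cM u x : lcs_ideal A k.+2 x -> lcs A k.+3 (comm u x).
  have -> : k.+2 = (k.+1./2).*2.+1
    by rewrite -[in LHS](odd_double_half k.+1) (negPf kodd).
  exact: comm_odd_ideal.
set L := short_words (N + N).
pose E := [seq comm u c | u <- L, c <- [seq comm v w | v <- L, w <- L]].
exists E; set D := [set x | exists2 e, span [set` E] e & lcs A k.+3 (x - e)].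
have DP : submodule D by apply: finite_mod_submodule.
have DM x : lcs A k.+3 x -> D x.
  by exists 0; rewrite ?subr0 //; apply: (submod0 (span_submodule _)).
suff Dw : forall u v w, D (comm u (comm v w)).
  suff sD : lcs A 3 `<=` D by move=> x /sD.
  apply: lcs_min => // u l l2; move: l l2.
  apply: (@lcs_min _ _ _ [set l | D (comm u l)]) => [|v w _]; last exact: Dw.
  split=> [|c x y Dx Dy] /=; first by rewrite comm0r; apply: DP.1.
  by rewrite commDr commZr; apply: DP.2.
move=> u v w; move: u; apply: words_ind => // [c u u'|n u uY].
  by rewrite commDl commZl.
move: v; apply: words_ind => // [c v v'|m v vY].
  by rewrite (commDl _ _ w) commZl (commDr u) commZr.
move: w; apply: words_ind => // [c w w'|l w wY].
  by rewrite (commDr v) commZr (commDr u) commZr.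
have [Nn|nN] := leqP (N + N) n.
  apply: DM; rewrite comm_jacobi (commC _ w); apply: (submodD WP).
    by apply: (submodN WP); apply: cM; apply: comm_long_word uY.
  by apply: cM; apply: comm_long_word uY.
have [Nm|mN] := leqP (N + N) m.
  by apply: DM; apply: cM; apply: comm_long_word vY.
have [Nl|lN] := leqP (N + N) l.
  apply: DM; apply: cM; rewrite commC; apply: (idealN (lcs_idealP _)).
  exact: comm_long_word wY.
exists (comm u (comm v w)); last by rewrite subrr; apply: WP.1.
apply: sub_span; apply: allpairs_f; first exact: mem_short_words uY.
by apply: allpairs_f; [apply: mem_short_words vY|apply: mem_short_words wY].
Qed.

End Finiteness.

End Conductor.

Local Close Scope ring_scope.
Local Close Scope classical_set_scope.

Theorem theorem5p1 (A : algType rat) (gr : nat -> set A)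
    (hgr : is_grading gr)
    (hfg : finitely_generated A)
    (hgen : generates (gr 1))
    (hdim : krull_dim_le (abelianization A) 1)
    (hred : finite_set (nonreduced_points (abelianization A))) :
  (forall k : nat, 3 <= k -> fin_dim (B_quot A k)) /\
  (forall j : nat, 2 <= j -> fin_dim (N_quot A j)).
Proof.
have [Y [Y1 gY]] := finite_generators hfg hgen.
have long := long_words_in_conductor hgr hgen gY Y1 hdim hred.
split=> k lek.
(* an odd index of the ideal, large enough for [L_(k+1)] *)
- have [N hN] := long (k.*2).+1.
  have [|E hE] := finite_mod_lcs gY hN; first by rewrite /= odd_double.
  apply: (@fin_dim_subquot _ _ (lcs_subspace A k) (lcs_subspace A k.+1) E) =>
    x /(lcs_le lek)/hE[e Ee We].
  by exists e => //; apply: lcs_le We; lia.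
- have [N hN] := long k.
  have [E hE] := finite_mod_ideal gY hN.
  apply: (@fin_dim_subquot _ _ (lcs_ideal_subspace A k) (lcs_ideal_subspace A
    k.+1) E) => x /(lcs_ideal_le lek)/hE[e Ee We].
  by exists e => //; apply: lcs_ideal_le We; lia.
Qed.
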